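(* For every $L\ge1$, $\mathcal B^{\times L}$ is a geometric crystal. Namely (it is a geometric pre-crystal and) $$e_j^de_i^c(\boldsymbol x)=e_i^ce_j^d(\boldsymbol x)\quad\text{if }\langle\alpha_i^\vee,\alpha_j\rangle=0,$$ $$e_i^de_j^{cd}e_i^c(\boldsymbol x)=e_j^ce_i^{cd}e_j^d(\boldsymbol x)\quad\text{if }\langle\alpha_i^\vee,\alpha_j\rangle=\langle\alpha_j^\vee,\alpha_i\rangle=-1.$$
   Context: Let $n\ge 4$, $I=\{0,1,\dots,n\}$. For type $D^{(1)}_n$: $\langle\alpha_i^\vee,\alpha_i\rangle=2$; for $i\ne j$, $\langle\alpha_i^\vee,\alpha_j\rangle=-1$ if $\{i,j\}$ is $\{0,2\}$, $\{n-2,n\}$ or $\{k,k+1\}$ with $1\le k\le n-2$, and $0$ otherwise. Variables are real; all maps and identities are rational (identities hold wherever both sides are defined); $c,d$ are parameters; composition of maps is written by juxtaposition; empty products are $1$. **Geometric (pre-)crystal.** A geometric pre-crystal consists of a tuple of variables $x$, rational functions $\varepsilon_i,\varphi_i$ of $x$ and rational transformations $e_i^c$ ($i\in I$, $c$ a parameter) such that, with $\gamma_i=\varphi_i/\varepsilon_i$: (i) $e_i^{c_1}e_i^{c_2}(x)=e_i^{c_1c_2}(x)$, $e_i^1(x)=x$; (ii) $\varepsilon_i(e_i^c(x))=c^{-1}\varepsilon_i(x)$, $\varphi_i(e_i^c(x))=c\varphi_i(x)$; (iii) $\gamma_i(e_j^c(x))=c^{\langle\alpha_i^\vee,\alpha_j\rangle}\gamma_i(x)$.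 It is a geometric crystal if moreover $e_i^{c_1}e_j^{c_2}=e_j^{c_2}e_i^{c_1}$ when $\langle\alpha_i^\vee,\alpha_j\rangle=0$ and $e_i^{c_1}e_j^{c_1c_2}e_i^{c_2}=e_j^{c_2}e_i^{c_1c_2}e_j^{c_1}$ when $\langle\alpha_i^\vee,\alpha_j\rangle=\langle\alpha_j^\vee,\alpha_i\rangle=-1$. **The geometric $D^{(1)}_n$-crystal $\mathcal B$.** Variables $x=(x_1,\dots,x_n,\bar x_{n-1},\dots,\bar x_1)$. Functions: $\varepsilon_0(x)=x_1(\frac{x_2}{\bar x_2}+1)$, $\varphi_0(x)=\bar x_1(\frac{\bar x_2}{x_2}+1)$; $\varepsilon_i(x)=\bar x_i(\frac{x_{i+1}}{\bar x_{i+1}}+1)$, $\varphi_i(x)=x_i(\frac{\bar x_{i+1}}{x_{i+1}}+1)$ for $1\le i\le n-2$; $\varepsilon_{n-1}(x)=x_n\bar x_{n-1}$, $\varphi_{n-1}(x)=x_{n-1}$; $\varepsilon_n(x)=\bar x_{n-1}$, $\varphi_n(x)=x_{n-1}x_n$. With $\xi_i=\frac{x_i+c\bar x_i}{x_i+\bar x_i}$, the map $e_i^c$ changes only the listed coordinates: $e_0^c$: $x_1\mapsto\xi_2^{-1}x_1$, $x_2\mapsto c^{-1}\xi_2x_2$, $\bar x_2\mapsto\xi_2\bar x_2$, $\bar x_1\mapsto c\xi_2^{-1}\bar x_1$; $e_i^c$ ($1\le i\le n-2$): $x_i\mapsto c\xi_{i+1}^{-1}x_i$, $x_{i+1}\mapsto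 c^{-1}\xi_{i+1}x_{i+1}$, $\bar x_{i+1}\mapsto\xi_{i+1}\bar x_{i+1}$, $\bar x_i\mapsto\xi_{i+1}^{-1}\bar x_i$; $e_{n-1}^c$: $x_{n-1}\mapsto cx_{n-1}$, $x_n\mapsto c^{-1}x_n$; $e_n^c$: $x_n\mapsto cx_n$, $\bar x_{n-1}\mapsto c^{-1}\bar x_{n-1}$. **Product $\mathcal B^{\times L}$.** Variables $\boldsymbol x=(x^1,\dots,x^L)$, each $x^l$ a set of variables of $\mathcal B$. $$\varepsilon_i(\boldsymbol x)=\frac{\sum_{k=1}^L\prod_{j=1}^k\varepsilon_i(x^j)\prod_{j=k}^{L-1}\varphi_i(x^j)}{\prod_{j=1}^{L-1}\varphi_i(x^j)},\quad \varphi_i(\boldsymbol x)=\frac{\sum_{k=1}^L\prod_{j=2}^k\varepsilon_i(x^j)\prod_{j=k}^{L}\varphi_i(x^j)}{\prod_{j=2}^{L}\varepsilon_i(x^j)},$$ $e_i^c(\boldsymbol x)=(e_i^{c_1}(x^1),\dots,e_i^{c_L}(x^L))$ with $$c_l=\frac{\sum_{k=1}^Lc^{\theta(k\le l)}\prod_{j=2}^k\varepsilon_i(x^j)\prod_{j=k}^{L-1}\varphi_i(x^j)}{\sum_{k=1}^Lc^{\theta(k\le l-1)}\prod_{j=2}^k\varepsilon_i(x^j)\prod_{j=k}^{L-1}\varphi_i(x^j)},$$ where $\theta(s)=1$ if $s$ is true and $0$ otherwise. *)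

(* Defs.v *)
From HB Require Import structures.
From mathcomp Require Import all_boot all_order all_algebra.
From mathcomp Require Import reals.

Set Implicit Arguments.
Unset Strict Implicit.
Unset Printing Implicit Defensive.

Import Order.TTheory GRing.Theory Num.Theory.
Local Open Scope ring_scope.

(* Rational functions in the variables V are given by formulas, so that their
   domain of definition is explicit: no division by zero occurs anywhere in the
   evaluation. (GRing.term is not used: its variables are numbered by nat,
   it has no simultaneous substitution, and its evaluation is total.) *)
Inductive ratexp (R V : Type) : Type :=
| RVar of V
| RConst of R
| RAdd of ratexp R V & ratexp R V
| ROpp of ratexp R V
| RMul of ratexp R V & ratexp R V
| RInv of ratexp R V.

Arguments RVar {R V}.
Arguments RConst {R V}.

Declare Scope ratexp_scope.
Delimit Scope ratexp_scope with RE.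
Bind Scope ratexp_scope with ratexp.
Notation "0" := (RConst 0%R) : ratexp_scope.
Notation "1" := (RConst 1%R) : ratexp_scope.
Notation "a + b" := (RAdd a b) : ratexp_scope.
Notation "a * b" := (RMul a b) : ratexp_scope.
Notation "a ^-1" := (RInv a) : ratexp_scope.
Notation "a / b" := (RMul a (RInv b)) : ratexp_scope.

Fixpoint rsubst (R V W : Type) (s : V -> ratexp R W) (t : ratexp R V)
    : ratexp R W :=
  match t with
  | RVar v => s v
  | RConst r => RConst r
  | RAdd a b => RAdd (rsubst s a) (rsubst s b)
  | ROpp a => ROpp (rsubst s a)
  | RMul a b => RMul (rsubst s a) (rsubst s b)
  | RInv a => RInv (rsubst s a)
  end.

Definition rrename (R V W : Type) (f : V -> W) : ratexp R V -> ratexp R W :=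
  rsubst (fun v => RVar (f v)).

Fixpoint reval (R : fieldType) (V : Type) (p : V -> R) (t : ratexp R V)
    : option R :=
  match t with
  | RVar v => Some (p v)
  | RConst r => Some r
  | RAdd a b =>
      if (reval p a, reval p b) is (Some x, Some y) then Some (x + y) else None
  | ROpp a => omap -%R (reval p a)
  | RMul a b =>
      if (reval p a, reval p b) is (Some x, Some y) then Some (x * y) else None
  | RInv a =>
      if reval p a is Some x then if x == 0 then None else Some x^-1 else None
  end.

(* Equality of rational functions (or maps) given by formulas: both sides are
   equal wherever both are defined, and this is not vacuous. *)
Definition ratmap_eq (P T : Type) (f g : P -> option T) : Prop :=
  (exists p, f p <> None /\ g p <> None) /\
  (forall p u v, f p = Some u -> g p = Some v -> u = v).

(* In cr_act i v, the coordinate v of e_i^c(x), the variable None stands for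
   the parameter c and Some w for the coordinate w of x. *)
Record crystal_data (R : Type) (I : Type) (V : finType) := CrystalData {
  cr_eps : I -> ratexp R V;
  cr_phi : I -> ratexp R V;
  cr_act : I -> V -> ratexp R (option V)
}.

Section GeometricCrystal.
Variables (R : fieldType) (I : Type) (V : finType).
Variable (A : I -> I -> int) (* A i j is <alpha_i^vee, alpha_j> *).
Variable (C : crystal_data R I V).

Definition point := {ffun V -> R}.

Definition cr_gamma (i : I) : ratexp R V := (cr_phi C i / cr_eps C i)%RE.

Definition cr_e (i : I) (c : R) (x : point) : option point :=
  let y v := reval (oapp x c) (cr_act C i v) in
  if [forall v, isSome (y v)] then Some [ffun v => odflt 0 (y v)] else None.

(* f(e_i^c(x)) = c^a f(x); c^a is undefined if c = 0 and a < 0. *)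
Definition scales_by (i : I) (f : ratexp R V) (a : int) : Prop :=
  ratmap_eq
    (fun '((c, x) : R * point) => obind (fun y : point => reval y f) (cr_e i c x))
    (fun '((c, x) : R * point) =>
       if (c == 0) && (a < 0) then None else omap (fun t => c ^ a * t) (reval x f)).

Record geometric_precrystal : Prop := GeometricPrecrystal {
  cr_e_mul : forall i, ratmap_eq
    (fun '((c1, c2, x) : R * R * point) => obind (cr_e i c1) (cr_e i c2 x))
    (fun '((c1, c2, x) : R * R * point) => cr_e i (c1 * c2) x);
  cr_e_one : forall i, ratmap_eq (cr_e i 1) Some;
  cr_eps_e : forall i, scales_by i (cr_eps C i) (-1);
  cr_phi_e : forall i, scales_by i (cr_phi C i) 1;
  cr_gamma_e : forall i j, scales_by j (cr_gamma i) (A i j)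
}.

Record geometric_crystal : Prop := GeometricCrystal {
  cr_pre : geometric_precrystal;
  cr_commute : forall i j, A i j = 0 -> ratmap_eq
    (fun '((c1, c2, x) : R * R * point) => obind (cr_e i c1) (cr_e j c2 x))
    (fun '((c1, c2, x) : R * R * point) => obind (cr_e j c2) (cr_e i c1 x));
  cr_braid : forall i j, A i j = -1 -> A j i = -1 -> ratmap_eq
    (fun '((c1, c2, x) : R * R * point) =>
       obind (cr_e i c1) (obind (cr_e j (c1 * c2)) (cr_e i c2 x)))
    (fun '((c1, c2, x) : R * R * point) =>
       obind (cr_e j c2) (obind (cr_e i (c1 * c2)) (cr_e j c1 x)))
}.

End GeometricCrystal.

(* The factors are numbered from 0: the ordinal l : 'I_L is the factor number
   l + 1 of the usual numbering x^1, ..., x^L. *)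
Section Product.
Variables (R : fieldType) (I : Type) (V : finType) (L : nat).
Variable C : crystal_data R I V.

Local Notation PV := (('I_L * V)%type : finType).

Definition eps_at (i : I) (j : 'I_L) : ratexp R PV :=
  rrename (fun v => (j, v)) (cr_eps C i).
Definition phi_at (i : I) (j : 'I_L) : ratexp R PV :=
  rrename (fun v => (j, v)) (cr_phi C i).

Definition prod_eps (i : I) : ratexp R PV :=
  ((\big[@RAdd R PV/0]_(k < L)
      ((\big[@RMul R PV/1]_(j < L | (j <= k)%N) eps_at i j)
       * \big[@RMul R PV/1]_(j < L | (k <= j < L.-1)%N) phi_at i j))
   / \big[@RMul R PV/1]_(j < L | (j < L.-1)%N) phi_at i j)%RE.

Definition prod_phi (i : I) : ratexp R PV :=
  ((\big[@RAdd R PV/0]_(k < L)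
      ((\big[@RMul R PV/1]_(j < L | (0 < j <= k)%N) eps_at i j)
       * \big[@RMul R PV/1]_(j < L | (k <= j)%N) phi_at i j))
   / \big[@RMul R PV/1]_(j < L | (0 < j)%N) eps_at i j)%RE.

(* The sum over k of c^theta(k) * prod_{j=2}^k eps_i(x^j)
   * prod_{j=k}^{L-1} phi_i(x^j), where c is the variable None. *)
Definition par_sum (i : I) (theta : 'I_L -> bool) : ratexp R (option PV) :=
  \big[@RAdd R (option PV)/0%RE]_(k < L)
    ((if theta k then RVar None else 1)
     * rrename some
         ((\big[@RMul R PV/1]_(j < L | (0 < j <= k)%N) eps_at i j)
          * \big[@RMul R PV/1]_(j < L | (k <= j < L.-1)%N) phi_at i j))%RE.

Definition prod_par (i : I) (l : 'I_L) : ratexp R (option PV) :=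
  (par_sum i (fun k => (k <= l)%N) / par_sum i (fun k => (k < l)%N))%RE.

Definition prod_act (i : I) (lv : PV) : ratexp R (option PV) :=
  rsubst (fun o => if o is Some w then RVar (Some (lv.1, w)) else prod_par i lv.1)
         (cr_act C i lv.2).

Definition crystal_prod : crystal_data R I PV :=
  CrystalData prod_eps prod_phi prod_act.

End Product.

Arguments crystal_prod {R I V} L C.

Section TypeD.
Variable n : nat.

Definition adjD (i j : nat) : bool :=
  [|| (i == 0) && (j == 2), (i == n - 2) && (j == n)
    | (1 <= i <= n - 2) && (j == i.+1)]%N.

Definition cartanD (i j : 'I_n.+1) : int :=
  if i == j then 2 else if adjD i j || adjD j i then -1 else 0.

(* inl k and inr k are the variables x_{k+1} and \bar x_{k+1}; for n >= 2 the
   index types are 'I_n and 'I_(n-1). *)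
Definition varD : finType := ('I_n.-1.+1 + 'I_n.-2.+1)%type.

(* Meaningful only for 1 <= k <= n, respectively 1 <= k <= n - 1. *)
Definition xvar (k : nat) : varD := inl (inord k.-1).
Definition bvar (k : nat) : varD := inr (inord k.-1).

Variable R : fieldType.

Definition epsD (i : 'I_n.+1) : ratexp R varD :=
  let x k := RVar (xvar k) in
  let b k := RVar (bvar k) in
  if i == 0%N :> nat then (x 1%N * (x 2%N / b 2%N + 1))%RE
  else if (i <= n - 2)%N then (b i * (x i.+1 / b i.+1 + 1))%RE
  else if i == (n - 1)%N :> nat then (x n * b (n - 1)%N)%RE
  else b (n - 1)%N.

Definition phiD (i : 'I_n.+1) : ratexp R varD :=
  let x k := RVar (xvar k) in
  let b k := RVar (bvar k) in
  if i == 0%N :> nat then (b 1%N * (b 2%N / x 2%N + 1))%RE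
  else if (i <= n - 2)%N then (x i * (b i.+1 / x i.+1 + 1))%RE
  else if i == (n - 1)%N :> nat then x (n - 1)%N
  else (x (n - 1)%N * x n)%RE.

Definition actD (i : 'I_n.+1) (v : varD) : ratexp R (option varD) :=
  let c := RVar None in
  let x k := RVar (Some (xvar k)) in
  let b k := RVar (Some (bvar k)) in
  let xi k := ((x k + c * b k) / (x k + b k))%RE in
  if i == 0%N :> nat then
    if v == xvar 1 then ((xi 2%N)^-1 * x 1%N)%RE
    else if v == xvar 2 then (c^-1 * xi 2%N * x 2%N)%RE
    else if v == bvar 2 then (xi 2%N * b 2%N)%RE
    else if v == bvar 1 then (c * (xi 2%N)^-1 * b 1%N)%RE
    else RVar (Some v)
  else if (i <= n - 2)%N then
    if v == xvar i then (c * (xi i.+1)^-1 * x i)%RE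
    else if v == xvar i.+1 then (c^-1 * xi i.+1 * x i.+1)%RE
    else if v == bvar i.+1 then (xi i.+1 * b i.+1)%RE
    else if v == bvar i then ((xi i.+1)^-1 * b i)%RE
    else RVar (Some v)
  else if i == (n - 1)%N :> nat then
    if v == xvar (n - 1) then (c * x (n - 1)%N)%RE
    else if v == xvar n then (c^-1 * x n)%RE
    else RVar (Some v)
  else
    if v == xvar n then (c * x n)%RE
    else if v == bvar (n - 1) then (c^-1 * b (n - 1)%N)%RE
    else RVar (Some v).

Definition crystalD : crystal_data R 'I_n.+1 varD := CrystalData epsD phiD actD.

End TypeD.

Arguments crystalD n R : clear implicits.

(* Main.v *)
Require Import Defs.
From mathcomp Require Import all_boot all_order all_algebra.
From mathcomp Require Import reals ring zify.

Set Implicit Arguments.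
Unset Strict Implicit.
Unset Printing Implicit Defensive.

Import Order.TTheory GRing.Theory Num.Theory.
Local Open Scope ring_scope.

(** Every formula in sight is subtraction free, so it is defined, with a
    positive value, wherever all variables are positive. Two rational formulas
    that agree at all positive points agree wherever both are defined
    ([eq_reval_of_positive]): moving a point p along s |-> p + s * (1, .., 1)
    makes it positive for large s, and a one-variable polynomial that vanishes
    for all large s is 0. Hence each axiom of a geometric crystal is an identity
    between positive real functions ([geometric_crystal_of_positive]).

    The axioms for the product do not follow formally from those for the
    factors; the braid relation needs a Lax matrix. For adjacent nodes i, j
    attach to a point x of one factor the lower triangular matrix

             ( 1       0        0           )
      F(x) = ( eps_i   a        0           )   a = eps_i / phi_i,
             ( E       a eps_j  a d         )   d = eps_j / phi_j,

    with a suitable function E of x. Writing X_i(u) and X_j(u) for the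
    elementary unipotent matrices 1 + u E_12 and 1 + u E_23, the action of e_i^c
    is a Gauss decomposition,

      X_i((c - 1) / eps_i(x)) F(x) = c F(e_i^c x) X_i((1 - 1/c) / phi_i(x)),

    and likewise for j, without the scalar c. The parameters c_l of the product
    action are exactly those for which the unipotent matrix leaving the factor l
    on the right enters the factor l + 1 on the left ([shear_left],
    [shear_right]). So a composite of the maps e_i, e_j transports an upper
    unitriangular matrix W_0 through the factors,
      W_l F(x^l) = k_l F(y^l) W_(l+1).
    Composition multiplies the W_0 ([transports_comp]), and by uniqueness of the
    Gauss decomposition W_0 determines all the y^l ([transports_inj]), provided
    that F together with functions invariant under e_i and e_j separates the
    points of a single factor. A relation between composites of e_i and e_j on
    the product is thereby reduced to an equality of two 3 x 3 unitriangular
    matrices. Their entries involve only eps_i, eps_j and the lower left entry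
    of the monodromy matrix F(x^1) ... F(x^L), which transforms in the same way
    ([actv_first], [actv_second]), and the equality is an identity of rational
    functions in these three quantities ([actv_braid]).

    For type D each adjacent pair of nodes has such a Lax matrix, because near
    the pair the crystal has one and the same form in suitable local coordinates
    ([local_pair], [lax_pair_of_local]). Nodes that are not adjacent either move
    disjoint sets of variables, or are the two ends of a fork of the Dynkin
    diagram, where the commutation is checked by hand. *)

(** * Evaluation of rational expressions and density of the positive points *)

Section Evaluation.
Variable R : fieldType.
Implicit Types V W : Type.

(** Evaluation with the convention 1/0 = 0; together with [wdef] it recovers
    [reval], and it commutes with substitution unconditionally. *)
Fixpoint teval V (p : V -> R) (t : ratexp R V) : R :=
  match t with
  | RVar v => p v
  | RConst r => r
  | RAdd a b => teval p a + teval p b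
  | ROpp a => - teval p a
  | RMul a b => teval p a * teval p b
  | RInv a => (teval p a)^-1
  end.

Fixpoint wdef V (p : V -> R) (t : ratexp R V) : bool :=
  match t with
  | RVar _ | RConst _ => true
  | RAdd a b | RMul a b => wdef p a && wdef p b
  | ROpp a => wdef p a
  | RInv a => wdef p a && (teval p a != 0)
  end.

Lemma revalE V (p : V -> R) t :
  reval p t = if wdef p t then Some (teval p t) else None.
Proof.
elim: t => [v|r|a IHa b IHb|a IHa|a IHa b IHb|a IHa] //=.
- by rewrite IHa IHb; case: (wdef p a); case: (wdef p b).
- by rewrite IHa; case: (wdef p a).
- by rewrite IHa IHb; case: (wdef p a); case: (wdef p b).
- by rewrite IHa; case: (wdef p a) => //=; case: eqP.
Qed.

Lemma eq_teval V (p q : V -> R) : p =1 q -> teval p =1 teval q.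
Proof.
move=> e; elim=> [v|r|a IHa b IHb|a IHa|a IHa b IHb|a IHa] //=;
by rewrite ?IHa ?IHb.
Qed.

Lemma eq_wdef V (p q : V -> R) : p =1 q -> wdef p =1 wdef q.
Proof.
move=> e; elim=> [v|r|a IHa b IHb|a IHa|a IHa b IHb|a IHa] //=;
by rewrite ?IHa ?IHb ?(eq_teval e).
Qed.

Lemma teval_subst V W (p : W -> R) (s : V -> ratexp R W) t :
  teval p (rsubst s t) = teval (fun v => teval p (s v)) t.
Proof.
by elim: t => [v|r|a IHa b IHb|a IHa|a IHa b IHb|a IHa] //=; rewrite ?IHa ?IHb.
Qed.

Lemma wdef_subst V W (p : W -> R) (s : V -> ratexp R W) t :
  (forall v, wdef p (s v)) ->
  wdef p (rsubst s t) = wdef (fun v => teval p (s v)) t.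
Proof.
move=> ws; elim: t => [v|r|a IHa b IHb|a IHa|a IHa b IHb|a IHa] //=;
by rewrite ?IHa ?IHb ?teval_subst ?ws.
Qed.

Lemma reval_subst V W (p : W -> R) (q : V -> R) (s : V -> ratexp R W) t u :
  (forall v, reval p (s v) = Some (q v)) -> reval q t = Some u ->
  reval p (rsubst s t) = Some u.
Proof.
move=> es.
have ws v : wdef p (s v) by have := es v; rewrite revalE; case: wdef.
have es' v : teval p (s v) = q v by have := es v; rewrite revalE ws => -[].
by rewrite !revalE wdef_subst // teval_subst (eq_teval es') (eq_wdef es').
Qed.

Lemma teval_sum V (p : V -> R) J (r : seq J) (P : pred J) (F : J -> ratexp R V) :
  teval p (\big[@RAdd R V/RConst 0]_(k <- r | P k) F k) =
  \sum_(k <- r | P k) teval p (F k).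
Proof. exact: (@big_morph _ _ (teval p) 0 +%R (RConst 0) (@RAdd R V)). Qed.

Lemma teval_prod V (p : V -> R) J (r : seq J) (P : pred J) (F : J -> ratexp R V) :
  teval p (\big[@RMul R V/RConst 1]_(k <- r | P k) F k) =
  \prod_(k <- r | P k) teval p (F k).
Proof. exact: (@big_morph _ _ (teval p) 1 *%R (RConst 1) (@RMul R V)). Qed.

Lemma wdef_sum V (p : V -> R) J (r : seq J) (P : pred J) (F : J -> ratexp R V) :
  (forall k, P k -> wdef p (F k)) ->
  wdef p (\big[@RAdd R V/RConst 0]_(k <- r | P k) F k).
Proof.
by move=> w; apply: (big_ind (fun t => wdef p t)) => //= a b -> ->.
Qed.

Lemma wdef_prod V (p : V -> R) J (r : seq J) (P : pred J) (F : J -> ratexp R V) :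
  (forall k, P k -> wdef p (F k)) ->
  wdef p (\big[@RMul R V/RConst 1]_(k <- r | P k) F k).
Proof.
by move=> w; apply: (big_ind (fun t => wdef p t)) => //= a b -> ->.
Qed.

(** The restriction of a rational expression to a line through a point of its
    domain is a quotient of polynomials whose denominator does not vanish at that
    point: for D one takes a multiple of all the denominators that occur in the
    evaluation, so that it controls the definedness too. *)
Lemma reval_on_line V (p q : V -> R) (t : ratexp R V) u :
  reval p t = Some u ->
  exists N D : {poly R}, [/\ D.[0] != 0, u = N.[0] / D.[0] &
    forall s, D.[s] != 0 ->
      reval (fun v => p v + s * q v) t = Some (N.[s] / D.[s])].
Proof.
elim: t u => [v|r|a IHa b IHb|a IHa|a IHa b IHb|a IHa] u /=.
- move=> [<-]; exists ((p v)%:P + 'X * (q v)%:P), 1.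
  by split=> [||s _]; rewrite ?hornerE /= ?oner_neq0 ?mul0r ?addr0 ?divr1 // !hornerE.
- move=> [<-]; exists r%:P, 1.
  by split=> [||s _]; rewrite ?hornerE ?oner_neq0 ?divr1.
- case: (reval p a) IHa => // xa /(_ _ erefl) [Na [Da [Da0 -> IHa]]].
  case: (reval p b) IHb => // xb /(_ _ erefl) [Nb [Db [Db0 -> IHb]]] [<-].
  exists (Na * Db + Nb * Da), (Da * Db); split=> [||s].
  + by rewrite hornerM mulf_neq0.
  + by rewrite !hornerE addf_div.
  rewrite hornerM mulf_eq0 negb_or => /andP[a0 b0].
  by rewrite IHa // IHb // !hornerE addf_div.
- case: (reval p a) IHa => // xa /(_ _ erefl) [Na [Da [Da0 -> IHa]]] [<-].
  exists (- Na), Da; split=> [//||s s0]; first by rewrite hornerN mulNr.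
  by rewrite IHa //= hornerN mulNr.
- case: (reval p a) IHa => // xa /(_ _ erefl) [Na [Da [Da0 -> IHa]]].
  case: (reval p b) IHb => // xb /(_ _ erefl) [Nb [Db [Db0 -> IHb]]] [<-].
  exists (Na * Nb), (Da * Db); split=> [||s].
  + by rewrite hornerM mulf_neq0.
  + by rewrite !hornerM mulf_div.
  rewrite hornerM mulf_eq0 negb_or => /andP[a0 b0].
  by rewrite IHa // IHb // !hornerM mulf_div.
case: (reval p a) IHa => // xa /(_ _ erefl) [Na [Da [Da0 -> IHa]]].
case: eqP => // /eqP nz [<-].
have Na0 : Na.[0] != 0 by apply: contraNneq nz => ->; rewrite mul0r.
(* The denominator must control N / D as well as its inverse, hence the
   unreduced fraction D D / (N D). *)
exists (Da * Da), (Na * Da); split=> [||s].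
+ by rewrite hornerM mulf_neq0.
+ by rewrite !hornerM -mulf_div divff // mulr1 invf_div.
rewrite hornerM mulf_eq0 negb_or => /andP[a0 b0].
rewrite IHa // ifN ?mulf_neq0 ?invr_eq0 //.
by rewrite !hornerM -mulf_div divff // mulr1 invf_div.
Qed.

End Evaluation.

Section Positivity.
Variable R : realFieldType.

Definition positive (V : Type) (p : V -> R) := forall v, 0 < p v.

Lemma poly_eq0_of_large (P : {poly R}) (M : R) :
  (forall s, M < s -> P.[s] = 0) -> P = 0.
Proof.
move=> P0; pose rs := [seq M + k.+1%:R | k <- iota 0 (size P)].
apply: (@roots_geq_poly_eq0 _ P rs); last by rewrite size_map size_iota.
- apply/allP => s /mapP[k _ ->]; apply/rootP/P0.
  by rewrite ltrDl ltr0n.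
- rewrite map_inj_uniq ?iota_uniq // => k l /addrI/eqP.
  by rewrite eqr_nat => /eqP[].
Qed.

(** Along the diagonal direction every line ends up among the positive points,
    where N1 / D1 and N2 / D2 agree unless a denominator vanishes; clearing the
    denominators gives a polynomial identity, which may be read at s = 0. *)
Lemma eq_reval_of_positive (V : finType) (t1 t2 : ratexp R V) :
  (forall p u1 u2, positive p ->
     reval p t1 = Some u1 -> reval p t2 = Some u2 -> u1 = u2) ->
  forall p u1 u2, reval p t1 = Some u1 -> reval p t2 = Some u2 -> u1 = u2.
Proof.
move=> tpos p u1 u2 /(reval_on_line (fun=> 1)) [N1 [D1 [D10 -> e1]]].
move=> /(reval_on_line (fun=> 1)) [N2 [D2 [D20 -> e2]]].
have P0 : (N1 * D2 - N2 * D1) * (D1 * D2) = 0.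
  apply: (@poly_eq0_of_large _ (\sum_v `|p v|)) => s Ms.
  rewrite hornerM [(D1 * D2).[s]]hornerM.
  have [->|d1] := eqVneq D1.[s] 0; first by rewrite mul0r mulr0.
  have [->|d2] := eqVneq D2.[s] 0; first by rewrite !mulr0.
  have pos : positive (fun v => p v + s * 1).
    move=> v; rewrite mulr1 addrC -ltrBlDr sub0r.
    apply: le_lt_trans Ms; apply: le_trans (ler_norm _) _.
    by rewrite normrN (bigD1 v) //= lerDl sumr_ge0.
  have /eqP := tpos _ _ _ pos (e1 _ d1) (e2 _ d2).
  by rewrite eqr_div // hornerD hornerN !hornerM => /eqP ->; rewrite subrr mul0r.
have D0 : D1 * D2 != 0.
  by apply: contraNneq (mulf_neq0 D10 D20) => e; rewrite -hornerM e horner0.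
move/eqP: P0; rewrite mulf_eq0 (negPf D0) orbF subr_eq0 => /eqP e.
by apply/eqP; rewrite eqr_div // -!hornerM e.
Qed.

End Positivity.

(** * Reduction of the axioms to positive points *)
Section RationalMaps.
Variable R : realFieldType.

(** Only one direction is required: the formula G may be defined at points where
    the map f is not. This makes the property stable under composition. *)
Definition rational (W : Type) (T J : Type) (co : T -> J -> R)
    (f : (W -> R) -> option T) :=
  exists G : J -> ratexp R W, forall p u, f p = Some u ->
    forall j, reval p (G j) = Some (co u j).

(** A point of the domain P is a tuple of parameters and coordinates; [enc]
    lists its entries as a valuation of a single set W of variables. *)
Lemma ratmap_eq_of_positive (P T J : Type) (W : finType) (co : T -> J -> R)
    (dec : (W -> R) -> P) (enc : P -> W -> R) (f g : P -> option T) :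
  cancel enc dec -> (forall u v, co u =1 co v -> u = v) ->
  rational co (f \o dec) -> rational co (g \o dec) ->
  (forall p, positive p -> exists u, f (dec p) = Some u /\ g (dec p) = Some u) ->
  ratmap_eq f g.
Proof.
move=> encK co_inj [F repF] [G repG] fg; split.
  have [u [fu gu]] := fg (fun=> 1) (fun=> ltr01).
  by exists (dec (fun=> 1)); rewrite fu gu.
move=> q u v; rewrite -(encK q) => fu gv; apply: co_inj => j.
apply: (@eq_reval_of_positive _ _ (F j) (G j) _ (enc q)); first last.
- exact: repG.
- exact: repF.
move=> p u1 u2 /fg[w [fw gw]].
by rewrite (repF _ _ fw) (repG _ _ gw) => -[<-] [<-].
Qed.

Fixpoint rpow (W : Type) (t : ratexp R W) (m : nat) : ratexp R W :=
  if m is m'.+1 then RMul t (rpow t m') else RConst 1.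

Definition rzpow (W : Type) (t : ratexp R W) (a : int) : ratexp R W :=
  match a with Posz m => rpow t m | Negz m => RInv (rpow t m.+1) end.

Lemma reval_rzpow (W : Type) (p : W -> R) w (a : int) :
  ((p w == 0) && (a < 0)) = false ->
  reval p (rzpow (RVar w) a) = Some (p w ^ a).
Proof.
have ev m : reval p (rpow (RVar w) m) = Some (p w ^+ m).
  by elim: m => //= m ->; rewrite exprS.
case: a => m; first by move=> _; rewrite /= ev.
have -> : (Negz m < 0) = true by [].
rewrite andbT => pw; change (reval p (RInv (rpow (RVar w) m.+1)) = Some (p w ^- m.+1)).
by rewrite [reval _ _]/= -/(reval p (rpow (RVar w) m)) ev -exprS expf_eq0 pw.
Qed.

End RationalMaps.

Section PositivePart.
Variables (R : realFieldType) (I : Type) (V : finType).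
Variable C : crystal_data R I V.
Implicit Types (x : {ffun V -> R}) (c : R).

Definition epsv i x : R := teval x (cr_eps C i).
Definition phiv i x : R := teval x (cr_phi C i).
Definition actv i c x : {ffun V -> R} :=
  [ffun v => teval (oapp x c) (cr_act C i v)].

Definition pdef (W : Type) (p : W -> R) t := wdef p t && (0 < teval p t).

Record positive_crystal : Prop := PositiveCrystal {
  pdef_eps : forall i x, positive x -> pdef x (cr_eps C i);
  pdef_phi : forall i x, positive x -> pdef x (cr_phi C i);
  pdef_act : forall i c x v, 0 < c -> positive x -> pdef (oapp x c) (cr_act C i v)
}.

Hypothesis posC : positive_crystal.

Lemma epsv_gt0 i x : positive x -> 0 < epsv i x.
Proof. by move=> /(pdef_eps posC i)/andP[]. Qed.

Lemma phiv_gt0 i x : positive x -> 0 < phiv i x.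
Proof. by move=> /(pdef_phi posC i)/andP[]. Qed.

Lemma actv_gt0 i c x : 0 < c -> positive x -> positive (actv i c x).
Proof. by move=> c0 x0 v; rewrite ffunE; case/andP: (pdef_act posC i v c0 x0). Qed.

Lemma reval_eps i x : positive x -> reval x (cr_eps C i) = Some (epsv i x).
Proof. by move=> /(pdef_eps posC i)/andP[w _]; rewrite revalE w. Qed.

Lemma reval_phi i x : positive x -> reval x (cr_phi C i) = Some (phiv i x).
Proof. by move=> /(pdef_phi posC i)/andP[w _]; rewrite revalE w. Qed.

Lemma reval_gamma i x : positive x ->
  reval x (cr_gamma C i) = Some (phiv i x / epsv i x).
Proof.
by move=> x0; rewrite /= reval_phi // reval_eps // gt_eqF // epsv_gt0.
Qed.

Lemma cr_eE i c x : 0 < c -> positive x -> cr_e C i c x = Some (actv i c x).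
Proof.
move=> c0 x0.
have ev v : reval (oapp x c) (cr_act C i v) = Some (actv i c x v).
  by case/andP: (pdef_act posC i v c0 x0) => w _; rewrite ffunE revalE w.
rewrite /cr_e; have -> : [forall v, reval (oapp x c) (cr_act C i v)].
  by apply/forallP => v; rewrite ev.
by congr Some; apply/ffunP => v; rewrite ffunE ev.
Qed.

Lemma cr_e_Some i c x y : cr_e C i c x = Some y ->
  forall v, reval (oapp x c) (cr_act C i v) = Some (y v).
Proof.
rewrite /cr_e; case: forallP => // dfd [<-] v; rewrite ffunE.
by have := dfd v; case: reval.
Qed.

Definition coord (x : {ffun V -> R}) : V -> R := x.

Lemma rational_e (W : Type) i (c : (W -> R) -> R) t f :
  (forall p, reval p t = Some (c p)) -> rational coord f ->
  rational coord (fun p : W -> R => obind (cr_e C i (c p)) (f p)).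
Proof.
move=> ct [F repF]; exists (fun v => rsubst (oapp F t) (cr_act C i v)) => p y /=.
case fE : (f p) => [z|] //= /cr_e_Some ey v.
by apply: reval_subst (ey v) => -[w|] //=; apply: repF.
Qed.

Lemma rational_reval (W : Type) (t : ratexp R V) (f : (W -> R) -> option {ffun V -> R}) :
  rational coord f ->
  rational (fun u (_ : unit) => u) (fun p => obind (fun y : {ffun V -> R} => reval y t) (f p)).
Proof.
move=> [F repF]; exists (fun _ => rsubst F t) => p u.
case fE : (f p) => [z|] //= tu _.
by apply: reval_subst tu => v; apply: repF.
Qed.

Lemma rational_var (W : Type) (g : V -> W) :
  rational coord (fun p : W -> R => Some [ffun v => p (g v)]).
Proof. by exists (fun v => RVar (g v)) => p _ [<-] v /=; rewrite /coord ffunE. Qed.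

Definition decode0 (p : V -> R) : {ffun V -> R} := [ffun v => p v].
Definition decode1 (p : option V -> R) := (p None, [ffun v => p (Some v)]).
Definition decode2 (p : option (option V) -> R) :=
  (p None, p (Some None), [ffun v => p (Some (Some v))]).

Lemma ffun_id x : [ffun v => x v] = x.
Proof. by apply/ffunP => v; rewrite ffunE. Qed.

Lemma decode1K : cancel (fun q : R * {ffun V -> R} => oapp q.2 q.1) decode1.
Proof. by case=> c x; congr pair; apply: ffun_id. Qed.

Lemma decode2K :
  cancel (fun q : R * R * {ffun V -> R} => oapp (oapp q.2 q.1.2) q.1.1) decode2.
Proof. by case=> -[c d] x; congr pair; apply: ffun_id. Qed.

Lemma positive_ffun (W : Type) (p : W -> R) (g : V -> W) :
  positive p -> positive [ffun v => p (g v)].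
Proof. by move=> p0 v; rewrite ffunE. Qed.

Lemma coord_inj (x y : {ffun V -> R}) : coord x =1 coord y -> x = y.
Proof. by move=> xy; apply/ffunP. Qed.

Lemma scales_by_of_positive i t (a : int) (f : {ffun V -> R} -> R) :
  (forall x, positive x -> reval x t = Some (f x)) ->
  (forall c x, 0 < c -> positive x -> f (actv i c x) = c ^ a * f x) ->
  scales_by C i t a.
Proof.
move=> tf fact; apply: (ratmap_eq_of_positive (co := fun u (_ : unit) => u) decode1K) => //=.
- by move=> u v /(_ tt).
- pose x1 (p : option V -> R) := p None.
  have rx := @rational_e _ i x1 (RVar None) _ (fun=> erefl) (rational_var Some).
  exact: (rational_reval t rx).
- exists (fun=> RMul (rzpow (RVar None) a) (rsubst (fun v => RVar (Some v)) t)) => p u.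
  rewrite /comp /=; case: ifP => // c0; case tu : (reval _ t) => [z|] //= [<-] _.
  rewrite (reval_rzpow c0) (reval_subst _ tu) // => v /=.
  by rewrite ffunE.
move=> p p0; have x0 := positive_ffun (@Some V) p0.
rewrite cr_eE //= tf; last exact: actv_gt0.
by rewrite tf // gt_eqF // fact //; eexists.
Qed.

Variable A : I -> I -> int.

(** Both sides of each axiom are compositions of the rational maps e_i^c, the
    functions eps_i, phi_i and powers of the parameters, hence rational. *)
Lemma geometric_crystal_of_positive :
  (forall i c1 c2 x, 0 < c1 -> 0 < c2 -> positive x ->
     actv i c1 (actv i c2 x) = actv i (c1 * c2) x) ->
  (forall i x, positive x -> actv i 1 x = x) ->
  (forall i c x, 0 < c -> positive x -> epsv i (actv i c x) = c^-1 * epsv i x) ->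
  (forall i c x, 0 < c -> positive x -> phiv i (actv i c x) = c * phiv i x) ->
  (forall i j c x, 0 < c -> positive x ->
     phiv i (actv j c x) / epsv i (actv j c x) =
     c ^ A i j * (phiv i x / epsv i x)) ->
  (forall i j c1 c2 x, A i j = 0 -> 0 < c1 -> 0 < c2 -> positive x ->
     actv i c1 (actv j c2 x) = actv j c2 (actv i c1 x)) ->
  (forall i j c1 c2 x, A i j = -1 -> A j i = -1 ->
     0 < c1 -> 0 < c2 -> positive x ->
     actv i c1 (actv j (c1 * c2) (actv i c2 x)) =
     actv j c2 (actv i (c1 * c2) (actv j c1 x))) ->
  geometric_crystal A C.
Proof.
move=> Hmul H1 Heps Hphi Hgamma Hcomm Hbraid.
pose P1 := fun p : option (option V) -> R => p None.
pose P2 := fun p : option (option V) -> R => p (Some None).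
pose P12 := fun p : option (option V) -> R => p None * p (Some None).
have rx : rational coord (fun p : option (option V) -> R =>
    Some [ffun v => p (Some (Some v))]).
  exact: rational_var (fun v => Some (Some v)).
have r1 i := @rational_e _ i P1 (RVar None) _ (fun=> erefl).
have r2 i := @rational_e _ i P2 (RVar (Some None)) _ (fun=> erefl).
have r12 i := @rational_e _ i P12 (RMul (RVar None) (RVar (Some None))) _
  (fun=> erefl).
split; first split.
- move=> i; apply: (ratmap_eq_of_positive decode2K coord_inj) => //=.
  + exact: r1 (r2 _ _ rx).
  + exact: r12 rx.
  move=> p p0; have x0 := positive_ffun (fun v => Some (Some v)) p0.
  rewrite !cr_eE ?mulr_gt0 //=; eexists; split; last by [].
  by rewrite cr_eE ?Hmul //; apply: actv_gt0.
- move=> i; apply: (@ratmap_eq_of_positive _ _ _ _ _ coord decode0 (fun x => x)) => //=.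
  + exact: ffun_id.
  + exact: coord_inj.
  + exact: (@rational_e _ i (fun=> 1) (RConst 1) _ (fun=> erefl) (rational_var id)).
  + exact: rational_var id.
  move=> p p0; have x0 := positive_ffun id p0.
  by rewrite cr_eE //; exists (decode0 p); rewrite H1.
- move=> i; apply: (scales_by_of_positive (f := epsv i)) => [x x0|c x c0 x0].
    exact: reval_eps.
  by rewrite Heps // exprN1.
- move=> i; apply: (scales_by_of_positive (f := phiv i)) => [x x0|c x c0 x0].
    exact: reval_phi.
  by rewrite Hphi // expr1z.
- move=> i j.
  apply: (scales_by_of_positive (f := fun x => phiv i x / epsv i x)).
    by move=> x; apply: reval_gamma.
  by move=> c x c0 x0; apply: Hgamma.
- move=> i j Aij; apply: (ratmap_eq_of_positive decode2K coord_inj) => //=.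
  + exact: r1 (r2 _ _ rx).
  + exact: r2 (r1 _ _ rx).
  move=> p p0; have x0 := positive_ffun (fun v => Some (Some v)) p0.
  rewrite !cr_eE //= !cr_eE //; [|exact: actv_gt0..].
  by eexists; split; last by []; rewrite Hcomm.
move=> i j Aij Aji; apply: (ratmap_eq_of_positive decode2K coord_inj) => //=.
- exact: r1 (r12 _ _ (r2 _ _ rx)).
- exact: r2 (r12 _ _ (r1 _ _ rx)).
move=> p p0; have x0 := positive_ffun (fun v => Some (Some v)) p0.
have c0 : 0 < p None * p (Some None) by rewrite mulr_gt0.
rewrite [cr_e C i _ _]cr_eE // [cr_e C j _ _]cr_eE //=.
have x1 := actv_gt0 i (p0 (Some None)) x0.
have x2 := actv_gt0 j (p0 None) x0.
rewrite [cr_e C i _ _]cr_eE // [cr_e C j _ _]cr_eE //=.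
by rewrite !cr_eE ?Hbraid //; [eexists| apply: actv_gt0..].
Qed.

End PositivePart.

(** * The parameters of the product action *)
Section SplitSequence.
Variables (R : realFieldType) (L : nat).
Variables e f : 'I_L -> R.

(** Here e l and f l stand for the values of eps_i and phi_i at the factor l.
    Dividing the sum over k of the product formula by its common factor leaves
    the [summand]s eps(x^k) prod_(j < k) eps(x^j) / phi(x^j). Their sum is
    eps_i of the product, and multiplying the first m of them by c gives
    [deformed_sum], whose consecutive ratios are the parameters c_l. *)
Definition weight (m : nat) : R := \prod_(j < L | (j < m)%N) (e j / f j).
Definition summand (k : 'I_L) : R := weight k * e k.
Definition eps_total : R := \sum_(k < L) summand k.
Definition phi_total : R := eps_total * \prod_(k < L) (f k / e k).
Definition deformed_sum (c : R) (m : nat) : R :=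
  \sum_(k < L) (if (k < m)%N then c else 1) * summand k.
Definition factor_param (c : R) (l : 'I_L) : R := deformed_sum c l.+1 / deformed_sum c l.
(** The entry of the elementary unipotent matrix that enters the factor m (and,
    for m = L, of the one that leaves the last factor). *)
Definition shear (c : R) (m : nat) : R := (c - 1) * weight m / deformed_sum c m.

Lemma deformed_sum0 c : deformed_sum c 0 = eps_total.
Proof. by apply: eq_bigr => k _; rewrite mul1r. Qed.

Lemma deformed_sumL c : deformed_sum c L = c * eps_total.
Proof. by rewrite mulr_sumr; apply: eq_bigr => k _; rewrite ltn_ord. Qed.

Lemma deformed_sumS c (l : 'I_L) : deformed_sum c l.+1 = deformed_sum c l + (c - 1) * summand l.
Proof.
rewrite /deformed_sum (bigD1 l) //= [in RHS](bigD1 l) //= ltnSn ltnn.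
rewrite (eq_bigr (fun k : 'I_L => (if (k < l)%N then c else 1) * summand k)); first by ring.
by move=> k kl; rewrite ltnS ltn_neqAle -(inj_eq val_inj) /= in kl *; rewrite kl.
Qed.

Lemma weightS (l : 'I_L) : weight l.+1 = weight l * (e l / f l).
Proof.
rewrite /weight (bigD1 l) //= mulrC; congr (_ * _); apply: eq_bigl => k.
by rewrite ltnS [RHS]ltn_neqAle -(inj_eq val_inj) andbC.
Qed.

Hypothesis L_gt0 : (0 < L)%N.
Hypothesis e_gt0 : forall l, 0 < e l.
Hypothesis f_gt0 : forall l, 0 < f l.

Lemma weight_gt0 m : 0 < weight m.
Proof. by apply: prodr_gt0 => j _; rewrite divr_gt0. Qed.

Lemma summand_gt0 k : 0 < summand k.
Proof. by rewrite mulr_gt0 ?weight_gt0. Qed.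

Lemma sum_ord_gt0 (F : 'I_L -> R) : (forall k, 0 < F k) -> 0 < \sum_(k < L) F k.
Proof.
move=> F0; rewrite (bigD1 (Ordinal L_gt0)) //=.
by rewrite ltr_pwDl // sumr_ge0 // => k _; apply: ltW.
Qed.

Lemma eps_total_gt0 : 0 < eps_total.
Proof. exact: sum_ord_gt0 summand_gt0. Qed.

Lemma phi_total_gt0 : 0 < phi_total.
Proof. by rewrite mulr_gt0 ?eps_total_gt0 ?prodr_gt0 // => k _; rewrite divr_gt0. Qed.

Lemma deformed_sum_gt0 c m : 0 < c -> 0 < deformed_sum c m.
Proof. by move=> c0; apply: sum_ord_gt0 => k; rewrite mulr_gt0 ?summand_gt0 //; case: ifP. Qed.

Lemma factor_param_gt0 c l : 0 < c -> 0 < factor_param c l.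
Proof. by move=> c0; rewrite divr_gt0 ?deformed_sum_gt0. Qed.

(** The ratios telescope from [eps_total] to c times [eps_total]. *)
Lemma prod_factor_param c : 0 < c -> \prod_(l < L) factor_param c l = c.
Proof.
move=> c0; rewrite -(big_mkord xpredT (fun l => deformed_sum c l.+1 / deformed_sum c l)).
rewrite telescope_prodf ?deformed_sum0 ?deformed_sumL ?mulfK //.
  by rewrite gt_eqF ?eps_total_gt0.
by move=> k _ ; rewrite gt_eqF ?deformed_sum_gt0.
Qed.

Lemma shear0 c : shear c 0 = (c - 1) / eps_total.
Proof. by rewrite /shear deformed_sum0 /weight big_pred0 ?mulr1. Qed.

(** This lemma and the next one say that the chain of shears is consistent:
    for the factor l the entry (c_l - 1) / eps on its left and the entry
    (1 - 1/c_l) / phi on its right are neighbours in one sequence. Both hold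
    because the increments of [deformed_sum] are (c - 1) times the summands. *)
Lemma shear_left c (l : 'I_L) : 0 < c -> shear c l = (factor_param c l - 1) / e l.
Proof.
move=> c0; have n0 := @deformed_sum_gt0 c l c0.
rewrite /factor_param deformed_sumS /shear /summand.
by field; rewrite !gt_eqF.
Qed.

Lemma shear_right c (l : 'I_L) :
  0 < c -> shear c l.+1 = (1 - (factor_param c l)^-1) / f l.
Proof.
move=> c0; have n0 := @deformed_sum_gt0 c l c0; have := @deformed_sum_gt0 c l.+1 c0.
rewrite /factor_param /shear weightS deformed_sumS /summand => n1.
by field; rewrite !gt_eqF //= mulrC.
Qed.

(** The common factor prod phi, over all j satisfying P; P is the bound
    j < L - 1 in the formulas for eps and c_l, and no condition in that for
    phi. *)
Lemma summand_prod (P : pred 'I_L) (k : 'I_L) :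
  (forall j : 'I_L, (j < k)%N -> P j) ->
  (\prod_(j < L | (j <= k)%N) e j) * \prod_(j < L | (k <= j)%N && P j) f j =
  (\prod_(j < L | P j) f j) * summand k.
Proof.
move=> ltP; have -> : \prod_(j < L | (j <= k)%N) e j = \prod_(j < L | (j < k)%N) e j * e k.
  rewrite (bigD1 k) //= mulrC; congr (_ * _); apply: eq_bigl => j.
  by rewrite [RHS]ltn_neqAle -(inj_eq val_inj) andbC.
rewrite mulrAC /summand [RHS]mulrA; congr (_ * _); rewrite /weight.
rewrite big_mkcond [X in _ * X]big_mkcond [X in _ = X * _]big_mkcond.
rewrite [X in _ = _ * X]big_mkcond -!big_split /=; apply: eq_bigr => j _.
case: (ltnP j k) => jk /=; last by rewrite mul1r mulr1.
by rewrite ltP // mulr1 mulrC divfK // gt_eqF.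
Qed.

Lemma prod_leq_eq (o k : 'I_L) : o = 0%N :> nat ->
  \prod_(j < L | (j <= k)%N) e j = e o * \prod_(j < L | (0 < j <= k)%N) e j.
Proof.
move=> o0; rewrite (bigD1 o) /=; last by rewrite o0.
congr (_ * _); apply: eq_bigl => j.
by rewrite andbC -(inj_eq val_inj) /= o0 lt0n.
Qed.

Lemma eps_totalE :
  (\sum_(k < L) (\prod_(j < L | (j <= k)%N) e j) *
       \prod_(j < L | (k <= j < L.-1)%N) f j) / \prod_(j < L | (j < L.-1)%N) f j
  = eps_total.
Proof.
rewrite (eq_bigr (fun k => (\prod_(j < L | (j < L.-1)%N) f j) * summand k)).
  by rewrite -mulr_sumr mulrC mulKf // gt_eqF // prodr_gt0.
move=> k _; rewrite summand_prod // => j jk.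
by have := ltn_ord k; lia.
Qed.

Lemma phi_totalE :
  (\sum_(k < L) (\prod_(j < L | (0 < j <= k)%N) e j) *
       \prod_(j < L | (k <= j)%N) f j) / \prod_(j < L | (0 < j)%N) e j
  = phi_total.
Proof.
pose o := Ordinal L_gt0; have eo : e o != 0 by rewrite gt_eqF.
have -> : \prod_(j < L | (0 < j)%N) e j = (e o)^-1 * \prod_(j < L) e j.
  rewrite [in RHS](bigD1 o) //= mulKf //; apply: eq_bigl => j.
  by rewrite -(inj_eq val_inj) /= lt0n.
have p0 : \prod_(j < L) e j != 0 by rewrite gt_eqF // prodr_gt0.
rewrite (eq_bigr (fun k => (e o)^-1 * (\prod_(j < L) f j) * summand k)).
  rewrite -mulr_sumr -/eps_total /phi_total prodf_div.
  by field; rewrite eo p0.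
move=> k _; rewrite -mulrA -(@summand_prod predT) // (@prod_leq_eq o) //.
by rewrite -!mulrA mulKf //; congr (_ * _); apply: eq_bigl => j; rewrite andbT.
Qed.

Lemma par_sum_weightE (theta : 'I_L -> bool) c (o : 'I_L) : o = 0%N :> nat ->
  \sum_(k < L) (if theta k then c else 1) *
     ((\prod_(j < L | (0 < j <= k)%N) e j) *
      \prod_(j < L | (k <= j < L.-1)%N) f j)
  = (e o)^-1 * (\prod_(j < L | (j < L.-1)%N) f j) *
    \sum_(k < L) (if theta k then c else 1) * summand k.
Proof.
move=> o0; rewrite mulr_sumr; apply: eq_bigr => k _; rewrite [RHS]mulrCA; congr (_ * _).
rewrite -mulrA -summand_prod; last by move=> j jk; have := ltn_ord k; lia.
by rewrite (@prod_leq_eq o) // -mulrA mulKf // gt_eqF.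
Qed.

Lemma factor_paramE c (l : 'I_L) :
  (\sum_(k < L) (if (k <= l)%N then c else 1) *
     ((\prod_(j < L | (0 < j <= k)%N) e j) *
      \prod_(j < L | (k <= j < L.-1)%N) f j)) /
  (\sum_(k < L) (if (k < l)%N then c else 1) *
     ((\prod_(j < L | (0 < j <= k)%N) e j) *
      \prod_(j < L | (k <= j < L.-1)%N) f j)) = factor_param c l.
Proof.
have o0 : Ordinal L_gt0 = 0%N :> nat by [].
rewrite !(par_sum_weightE _ _ o0) -mulf_div divff ?mul1r //.
by rewrite mulf_neq0 ?invr_eq0 // gt_eqF // prodr_gt0.
Qed.

End SplitSequence.

(** * The product crystal at positive points *)
Section ProductValues.
Variables (R : realFieldType) (I : Type) (V : finType) (L : nat).
Variable C : crystal_data R I V.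
Hypothesis L_gt0 : (0 < L)%N.
Hypothesis posC : positive_crystal C.
Local Notation PV := (('I_L * V)%type : finType).
Local Notation D := (crystal_prod L C).
Implicit Types (p : {ffun PV -> R}).

Definition factor p (l : 'I_L) : {ffun V -> R} := [ffun v => p (l, v)].

Definition epsf i p (l : 'I_L) := epsv C i (factor p l).
Definition phif i p (l : 'I_L) := phiv C i (factor p l).

Lemma positive_factor p l : positive p -> positive (factor p l).
Proof. by move=> p0 v; rewrite ffunE. Qed.

Lemma epsf_gt0 i p l : positive p -> 0 < epsf i p l.
Proof. by move=> p0; apply: epsv_gt0 => //; apply: positive_factor. Qed.

Lemma phif_gt0 i p l : positive p -> 0 < phif i p l.
Proof. by move=> p0; apply: phiv_gt0 => //; apply: positive_factor. Qed.

Lemma factor_inj p q : (forall l, factor p l = factor q l) -> p = q.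
Proof.
move=> pq; apply/ffunP => -[l v].
by have := congr1 (fun x : {ffun V -> R} => x v) (pq l); rewrite !ffunE.
Qed.

Lemma teval_eps_at i j p : teval p (eps_at C i j) = epsf i p j.
Proof. by rewrite teval_subst; apply: eq_teval => v /=; rewrite ffunE. Qed.

Lemma teval_phi_at i j p : teval p (phi_at C i j) = phif i p j.
Proof. by rewrite teval_subst; apply: eq_teval => v /=; rewrite ffunE. Qed.

Lemma wdef_eps_at i j p : positive p -> wdef p (eps_at C i j).
Proof.
move=> p0; rewrite wdef_subst //.
have /andP[+ _] := pdef_eps posC i (positive_factor j p0).
rewrite (@eq_wdef _ _ (factor p j) (fun v => p (j, v))); first by [].
by move=> v; rewrite ffunE.
Qed.

Lemma wdef_phi_at i j p : positive p -> wdef p (phi_at C i j).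
Proof.
move=> p0; rewrite wdef_subst //.
have /andP[+ _] := pdef_phi posC i (positive_factor j p0).
rewrite (@eq_wdef _ _ (factor p j) (fun v => p (j, v))); first by [].
by move=> v; rewrite ffunE.
Qed.

Lemma epsv_prod i p : positive p -> epsv D i p = eps_total (epsf i p) (phif i p).
Proof.
move=> p0; rewrite -eps_totalE //; last by move=> l; apply: phif_gt0.
rewrite /epsv /= teval_sum teval_prod; congr (_ / _).
  apply: eq_bigr => k _ /=; rewrite !teval_prod.
  by congr (_ * _); apply: eq_bigr => j _; rewrite ?teval_eps_at ?teval_phi_at.
by apply: eq_bigr => j _; rewrite teval_phi_at.
Qed.

Lemma phiv_prod i p : positive p -> phiv D i p = phi_total (epsf i p) (phif i p).
Proof.
move=> p0; rewrite -phi_totalE //; [|by move=> l; apply: epsf_gt0|by move=> l; apply: phif_gt0].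
rewrite /phiv /= teval_sum teval_prod; congr (_ / _).
  apply: eq_bigr => k _ /=; rewrite !teval_prod.
  by congr (_ * _); apply: eq_bigr => j _; rewrite ?teval_eps_at ?teval_phi_at.
by apply: eq_bigr => j _; rewrite teval_eps_at.
Qed.

Lemma teval_par_sum i theta c p :
  teval (oapp p c) (par_sum C i theta) =
  \sum_(k < L) (if theta k then c else 1) *
     ((\prod_(j < L | (0 < j <= k)%N) epsf i p j) *
      \prod_(j < L | (k <= j < L.-1)%N) phif i p j).
Proof.
rewrite teval_sum; apply: eq_bigr => k _ /=.
rewrite !teval_subst; congr (_ * _); first by case: (theta k).
by rewrite /= !teval_prod; congr (_ * _); apply: eq_bigr => j _;
   rewrite ?teval_eps_at ?teval_phi_at.
Qed.

Lemma teval_prod_par i l c p : positive p ->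
  teval (oapp p c) (prod_par C i l) = factor_param (epsf i p) (phif i p) c l.
Proof.
move=> p0; rewrite /= !teval_par_sum factor_paramE //.
  by move=> k; apply: epsf_gt0.
by move=> k; apply: phif_gt0.
Qed.

Lemma wdef_prod_par i l c p : 0 < c -> positive p ->
  wdef (oapp p c) (prod_par C i l).
Proof.
move=> c0 p0.
have ws theta : wdef (oapp p c) (par_sum C i theta).
  apply: wdef_sum => k _ /=; apply/andP; split; first by case: (theta k).
  rewrite !wdef_subst //=.
  by apply/andP; split; apply: wdef_prod => j _; [apply: wdef_eps_at|apply: wdef_phi_at].
rewrite /= !ws /= teval_par_sum gt_eqF //.
apply: sum_ord_gt0 => // k.
by rewrite !mulr_gt0 ?prodr_gt0 // => [|j _|j _];
  [case: ifP|apply: epsf_gt0|apply: phif_gt0].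
Qed.

Lemma actv_subst i c p l v : 0 < c -> positive p ->
  teval (oapp p c) (prod_act C i (l, v)) =
  teval (oapp (factor p l) (factor_param (epsf i p) (phif i p) c l)) (cr_act C i v).
Proof.
move=> c0 p0; rewrite teval_subst; apply: eq_teval => -[w|] /=.
  by rewrite ffunE.
by rewrite -(teval_prod_par i l c p0).
Qed.

Lemma wdef_act_subst i c p l v : 0 < c -> positive p ->
  wdef (oapp p c) (prod_act C i (l, v)) =
  wdef (oapp (factor p l) (factor_param (epsf i p) (phif i p) c l)) (cr_act C i v).
Proof.
move=> c0 p0; rewrite wdef_subst => [|[w|]] //; last exact: wdef_prod_par.
apply: eq_wdef => -[w|] /=; first by rewrite ffunE.
by rewrite -(teval_prod_par i l c p0).
Qed.

Lemma factor_param_at_gt0 i c p l : 0 < c -> positive p ->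
  0 < factor_param (epsf i p) (phif i p) c l.
Proof.
move=> c0 p0; apply: factor_param_gt0 => // k; [exact: epsf_gt0|exact: phif_gt0].
Qed.

Lemma positive_crystal_prod : positive_crystal D.
Proof.
split=> [i p p0|i p p0|i c p [l v] c0 p0]; apply/andP; split.
- rewrite /= wdef_sum ?wdef_prod //=; first last.
  + by move=> k _ /=; rewrite !wdef_prod // => j _; rewrite ?wdef_eps_at ?wdef_phi_at.
  + by move=> k _; apply: wdef_phi_at.
  rewrite teval_prod; apply/prodf_neq0 => k _.
  by rewrite teval_phi_at gt_eqF ?phif_gt0.
- rewrite -/(epsv D i p) epsv_prod //; apply: eps_total_gt0 => // l.
    exact: epsf_gt0.
  exact: phif_gt0.
- rewrite /= wdef_sum ?wdef_prod //=; first last.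
  + by move=> k _ /=; rewrite !wdef_prod // => j _; rewrite ?wdef_eps_at ?wdef_phi_at.
  + by move=> k _; apply: wdef_eps_at.
  rewrite teval_prod; apply/prodf_neq0 => k _.
  by rewrite teval_eps_at gt_eqF ?epsf_gt0.
- rewrite -/(phiv D i p) phiv_prod //; apply: phi_total_gt0 => // l.
    exact: epsf_gt0.
  exact: phif_gt0.
- rewrite wdef_act_subst //.
  by case/andP: (pdef_act posC i v (factor_param_at_gt0 i l c0 p0) (positive_factor l p0)).
rewrite actv_subst //.
by case/andP: (pdef_act posC i v (factor_param_at_gt0 i l c0 p0) (positive_factor l p0)).
Qed.

(** At a positive point the product acts on each factor by the crystal operator
    of that factor, with the parameter c_l. *)
Lemma factor_actv i c p l : 0 < c -> positive p ->
  factor (actv D i c p) l =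
  actv C i (factor_param (epsf i p) (phif i p) c l) (factor p l).
Proof. by move=> c0 p0; apply/ffunP => v; rewrite !ffunE actv_subst. Qed.

End ProductValues.

(** * Gauss decompositions of 3 x 3 matrices *)
Section Matrices.
Variable R : realFieldType.

Definition i0 : 'I_3 := Ordinal (isT : (0 < 3)%N).
Definition i1 : 'I_3 := Ordinal (isT : (1 < 3)%N).
Definition i2 : 'I_3 := Ordinal (isT : (2 < 3)%N).

Lemma ord3_ind (P : 'I_3 -> Prop) : P i0 -> P i1 -> P i2 -> forall i, P i.
Proof.
move=> P0 P1 P2 [[|[|[|m]]] lm] //.
- by rewrite (_ : Ordinal lm = i0) //; apply: val_inj.
- by rewrite (_ : Ordinal lm = i1) //; apply: val_inj.
by rewrite (_ : Ordinal lm = i2) //; apply: val_inj.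
Qed.

Lemma mulmx3E (A B : 'M[R]_3) i j :
  (A *m B) i j = A i i0 * B i0 j + A i i1 * B i1 j + A i i2 * B i2 j.
Proof.
rewrite mxE !big_ord_recl big_ord0 addr0 addrA.
by congr (A _ _ * B _ _ + A _ _ * B _ _ + A _ _ * B _ _); apply: val_inj.
Qed.

Definition mx3 (s : seq (seq R)) : 'M[R]_3 :=
  \matrix_(i < 3, j < 3) nth 0 (nth [::] s i) j.

(** The rows are scaled so that products keep this shape: e and h then compose
    like eps_i and eps_j in a product of crystals ([mul_lower_mx]). *)
Definition lower_mx (e a h d E : R) : 'M[R]_3 :=
  mx3 [:: [:: 1; 0; 0]; [:: e; a; 0]; [:: E; a * h; a * d]].

Definition upper_mx (p q r : R) : 'M[R]_3 :=
  mx3 [:: [:: 1; p; r]; [:: 0; 1; q]; [:: 0; 0; 1]].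

Definition shear_mx (b : bool) (u : R) : 'M[R]_3 :=
  if b then upper_mx u 0 0 else upper_mx 0 u 0.

Definition unitri (W : 'M[R]_3) := exists p q r, W = upper_mx p q r.

Lemma mul_upper_mx p q r p' q' r' :
  upper_mx p q r *m upper_mx p' q' r' = upper_mx (p' + p) (q' + q) (r' + p * q' + r).
Proof.
apply/matrixP => i j; rewrite mulmx3E.
elim/ord3_ind: i; elim/ord3_ind: j; rewrite !mxE /=; ring.
Qed.

Lemma unitri_shear_mx b u : unitri (shear_mx b u).
Proof. by case: b; do 3!eexists. Qed.

Lemma unitri_mul V W : unitri V -> unitri W -> unitri (V *m W).
Proof.
by move=> [p [q [r ->]]] [p' [q' [r' ->]]]; rewrite mul_upper_mx; do 3!eexists.
Qed.

Lemma upper_mx0 : upper_mx 0 0 0 = 1%:M.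
Proof.
by apply/matrixP => i j; elim/ord3_ind: i; elim/ord3_ind: j; rewrite !mxE.
Qed.

Lemma shear_mx0 b : shear_mx b 0 = 1%:M.
Proof. by case: b; apply: upper_mx0. Qed.

Lemma mul_shear_mx b u v : shear_mx b u *m shear_mx b v = shear_mx b (u + v).
Proof. by case: b; rewrite /shear_mx mul_upper_mx; congr upper_mx; ring. Qed.

Lemma lower_mx1 : lower_mx 0 1 0 1 0 = 1.
Proof.
apply/matrixP => i j; elim/ord3_ind: i; elim/ord3_ind: j;
by rewrite !mxE /= ?mulr0 ?mulr1.
Qed.

Lemma mul_lower_mx e a h d E e' a' h' d' E' :
  a' != 0 ->
  lower_mx e a h d E *m lower_mx e' a' h' d' E' =
  lower_mx (e + a * e') (a * a') (h + d * h') (d * d') (E + a * h * e' + a * d * E').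
Proof.
move=> a'0; apply/matrixP => i j; rewrite mulmx3E.
elim/ord3_ind: i; elim/ord3_ind: j; rewrite !mxE /=; ring.
Qed.

Lemma scale_lower_upper_mx k e a h d E p q r :
  k *: (lower_mx e a h d E *m upper_mx p q r) =
  mx3 [:: [:: k; k * p; k * r];
          [:: k * e; k * (e * p + a); k * (e * r + a * q)];
          [:: k * E; k * (E * p + a * h); k * (E * r + a * h * q + a * d)]].
Proof.
apply/matrixP => i j; rewrite mxE mulmx3E.
elim/ord3_ind: i; elim/ord3_ind: j; rewrite !mxE /=; ring.
Qed.

Lemma mul_upper_lower_mx e a h d E p q r :
  upper_mx p q r *m lower_mx e a h d E =
  mx3 [:: [:: 1 + p * e + r * E; p * a + r * (a * h); r * (a * d)];
          [:: e + q * E; a + q * (a * h); q * (a * d)];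
          [:: E; a * h; a * d]].
Proof.
apply/matrixP => i j; rewrite mulmx3E.
elim/ord3_ind: i; elim/ord3_ind: j; rewrite !mxE /=; ring.
Qed.

Lemma mx3_inj a b c d e f g h k a' b' c' d' e' f' g' h' k' :
  mx3 [:: [:: a; b; c]; [:: d; e; f]; [:: g; h; k]] =
  mx3 [:: [:: a'; b'; c']; [:: d'; e'; f']; [:: g'; h'; k']] ->
  [/\ [/\ a = a', b = b' & c = c'], [/\ d = d', e = e' & f = f'] &
      [/\ g = g', h = h' & k = k']].
Proof.
move/matrixP => m; split; split.
- by have := m i0 i0; rewrite !mxE.
- by have := m i0 i1; rewrite !mxE.
- by have := m i0 i2; rewrite !mxE.
- by have := m i1 i0; rewrite !mxE.
- by have := m i1 i1; rewrite !mxE.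
- by have := m i1 i2; rewrite !mxE.
- by have := m i2 i0; rewrite !mxE.
- by have := m i2 i1; rewrite !mxE.
by have := m i2 i2; rewrite !mxE.
Qed.

(** Uniqueness of the Gauss decomposition; the scalars are fixed because the
    lower triangular factor has 1 as its first entry. *)
Lemma lower_upper_mx_inj k k' e a h d E e' a' h' d' E' V V' :
  k != 0 -> a != 0 -> unitri V -> unitri V' ->
  k *: (lower_mx e a h d E *m V) = k' *: (lower_mx e' a' h' d' E' *m V') ->
  lower_mx e a h d E = lower_mx e' a' h' d' E' /\ V = V'.
Proof.
move=> k0 a0 [p [q [r ->]]] [p' [q' [r' ->]]]; rewrite !scale_lower_upper_mx.
case/mx3_inj=> -[<- /(mulfI k0) <- /(mulfI k0) <-].
case=> /(mulfI k0) <- /(mulfI k0)/addrI <- /(mulfI k0)/addrI/(mulfI a0) <-.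
case=> /(mulfI k0) <- /(mulfI k0)/addrI/(mulfI a0) <- /(mulfI k0)/addrI/(mulfI a0) <-.
by [].
Qed.

(** Comparing entries in X_i(u) F = k F' V: the first row expresses the entries
    of V through F, after which the other rows give those of F'. *)
Lemma shear_first_row u k e a h d E e' a' h' d' E' V :
  k != 0 -> a != 0 -> unitri V ->
  shear_mx true u *m lower_mx e a h d E = k *: (lower_mx e' a' h' d' E' *m V) ->
  [/\ k = 1 + u * e, e = k * e', E = k * E' & h' = k * h - u * E].
Proof.
move=> k0 a0 [p [q [r ->]]]; rewrite mul_upper_lower_mx scale_lower_upper_mx.
case/mx3_inj=> -[k1 kp _] [eE ka _] [EE kh _].
rewrite !mul0r !addr0 in k1 kp eE ka; split=> //.
have a'E : k ^+ 2 * a' = a.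
  have: k * a = k * (k * (e' * p + a')) by rewrite -ka.
  have -> : k * (k * (e' * p + a')) = (k * e') * (k * p) + k ^+ 2 * a' by ring.
  rewrite -eE -kp -k1 => kaE; apply: (addrI (e * (u * a))).
  by rewrite -kaE; ring.
apply: (mulfI a0); rewrite -[in LHS]a'E.
have -> : a * (k * h - u * E) = k * (a * h) - (u * a) * E by ring.
rewrite kh kp EE; ring.
Qed.

(** The analogue for X_j(u), which fixes the first row; so there is no scalar. *)
Lemma shear_second_row u k e a h d E e' a' h' d' E' V :
  a != 0 -> unitri V ->
  shear_mx false u *m lower_mx e a h d E = k *: (lower_mx e' a' h' d' E' *m V) ->
  [/\ k = 1, e' = e + u * E, E' = E & h = (1 + u * h) * h'].
Proof.
move=> a0 [p [q [r ->]]]; rewrite mul_upper_lower_mx scale_lower_upper_mx.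
case/mx3_inj=> -[k1 kp _] [eE ka _] [EE kh _].
rewrite !mul0r !addr0 in k1 kp; rewrite -k1 !mul1r in kp eE ka EE kh.
rewrite -kp !mulr0 !add0r in ka kh; split=> //.
apply: (mulfI a0); rewrite kh -ka; ring.
Qed.

End Matrices.

(** * The monodromy matrix *)
Section TriangularProduct.
Variable R : realFieldType.

Lemma weight_recr L (e f : 'I_L.+1 -> R) m : (m <= L)%N ->
  weight e f m = weight (e \o widen_ord (leqnSn L)) (f \o widen_ord (leqnSn L)) m.
Proof. by move=> mL; rewrite /weight big_mkcond big_ord_recr /= ltnNge mL mulr1 -big_mkcond. Qed.

Lemma weight_full L (e f : 'I_L -> R) : weight e f L = \prod_(l < L) (e l / f l).
Proof. by apply: eq_bigl => l; rewrite ltn_ord. Qed.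

Lemma eps_total_recr L (e f : 'I_L.+1 -> R) :
  let w := widen_ord (leqnSn L) in
  eps_total e f = eps_total (e \o w) (f \o w) + \prod_(l < L) (e (w l) / f (w l)) * e ord_max.
Proof.
move=> w; rewrite /eps_total big_ord_recr; congr (_ + _).
  by apply: eq_bigr => k _; rewrite /summand weight_recr //= ltnW.
by rewrite /summand weight_recr // weight_full.
Qed.

(** The entries of a product of Lax matrices are eps_i and eps_j of the product
    crystal: these entries obey the recursion eps(x, y) = eps(x) + a(x) eps(y). *)
Lemma prod_lower_mx L (e f h g E : 'I_L -> R) :
  (forall l, e l / f l != 0) ->
  exists E', \prod_(l < L) (lower_mx (e l) (e l / f l) (h l) (h l / g l) (E l)) =
    lower_mx (eps_total e f) (\prod_(l < L) (e l / f l)) (eps_total h g)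
        (\prod_(l < L) (h l / g l)) E'.
Proof.
elim: L e f h g E => [|L IHL] e f h g E ef0.
  by exists 0; rewrite !big_ord0 /eps_total !big_ord0 lower_mx1.
have [|E' eq'] := IHL (e \o widen_ord (leqnSn L)) (f \o widen_ord (leqnSn L))
  (h \o widen_ord (leqnSn L)) (g \o widen_ord (leqnSn L))
  (E \o widen_ord (leqnSn L)); first by move=> l; apply: ef0.
eexists; rewrite big_ord_recr /= eq' !eps_total_recr !big_ord_recr /=.
by apply: mul_lower_mx.
Qed.

(** A chain of exchange relations passes from the factors to their product. *)
Lemma telescope_prod_mx n L (A B : 'I_L -> 'M[R]_n.+1) (X : nat -> 'M[R]_n.+1) :
  (forall l : 'I_L, exists2 k, k != 0 & X l *m A l = k *: (B l *m X l.+1)) ->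
  exists2 k, k != 0 & X 0%N *m \prod_(l < L) A l = k *: (\prod_(l < L) B l *m X L).
Proof.
elim: L A B => [|m IHm] A B AB.
  by exists 1; rewrite ?oner_neq0 // !big_ord0 scale1r -![_ *m _]/(_ * _) mulr1 mul1r.
have [|k k0 kE] := IHm (A \o widen_ord (leqnSn m)) (B \o widen_ord (leqnSn m)).
  by move=> l; have := AB (widen_ord (leqnSn m) l).
have [k' k'0 k'E] := AB ord_max.
exists (k * k'); first by rewrite mulf_neq0.
rewrite !big_ord_recr /= -![_ * A _]/(_ *m _) -![_ * B _]/(_ *m _) mulmxA kE.
by rewrite -scalemxAl -mulmxA k'E -scalemxAr scalerA mulmxA.
Qed.

End TriangularProduct.

(** * Adjacent nodes with a Lax matrix *)
Section LaxPair.
Variables (R : realFieldType) (I : Type) (V : finType).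
Variables (C : crystal_data R I V).
Implicit Types (c d : R) (x y : {ffun V -> R}).

Section Definitions.
Variables (i j : I) (E : {ffun V -> R} -> R).

(** The boolean selects the node, and the unipotent generator that goes with it
    ([shear_mx]), so that facts about one node are stated once. *)
Definition node (b : bool) : I := if b then i else j.

Definition lax x : 'M[R]_3 :=
  lower_mx (epsv C i x) (epsv C i x / phiv C i x)
      (epsv C j x) (epsv C j x / phiv C j x) (E x).

(** E is the lower left entry of the Lax matrix. The function inv collects
    quantities left unchanged by both nodes; it is there to make [lax_inj] hold
    when the crystal has more coordinates than the Lax matrix has entries. *)
Record lax_pair (T : Type) (inv : {ffun V -> R} -> T) : Prop := LaxPair {
  lax_actv : forall b c x, 0 < c -> positive x ->
    shear_mx b ((c - 1) / epsv C (node b) x) *m lax x =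
    (if b then c else 1) *:
      (lax (actv C (node b) c x) *m shear_mx b ((1 - c^-1) / phiv C (node b) x));
  inv_actv : forall b c x, 0 < c -> positive x -> inv (actv C (node b) c x) = inv x;
  lax_inj : forall x y, positive x -> positive y -> lax x = lax y -> inv x = inv y ->
    x = y
}.
End Definitions.

Variables (i j : I) (E : {ffun V -> R} -> R).
Variables (T : Type) (inv : {ffun V -> R} -> T).
Variable (L : nat).
Hypothesis L_gt0 : (0 < L)%N.
Hypothesis posC : positive_crystal C.
Hypothesis laxC : lax_pair i j E inv.
Local Notation PV := (('I_L * V)%type : finType).
Local Notation D := (crystal_prod L C).
Local Notation F := (lax i j E).
Local Notation nd := (node i j).
Implicit Types (p q r : {ffun PV -> R}).
Let posD : positive_crystal D := positive_crystal_prod L_gt0 posC.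

(** The point p is carried to q by letting the matrix W0 enter the first factor
    from the left and leave the last one on the right; W l is what reaches the
    factor l. *)
Definition transports (W0 : 'M[R]_3) p q :=
  exists W : nat -> 'M[R]_3, [/\ W 0%N = W0, forall m, unitri (W m) &
    forall l : 'I_L,
      (exists2 k, k != 0 &
         W l *m F (factor p l) = k *: (F (factor q l) *m W l.+1)) /\
      inv (factor p l) = inv (factor q l)].

Lemma transports_comp W W' p q r :
  transports W p q -> transports W' q r -> transports (W' *m W) p r.
Proof.
move=> [X [<- uX Xl]] [X' [<- uX' X'l]].
exists (fun m => X' m *m X m); split=> // [m|l]; first exact: unitri_mul.
have [[k k0 kE] ->] := Xl l; have [[k' k'0 k'E] ->] := X'l l.
split=> //; exists (k * k'); first by rewrite mulf_neq0.
by rewrite -mulmxA kE -scalemxAr [X in k *: X]mulmxA k'E -scalemxAl scalerA !mulmxA.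
Qed.

Lemma lax_ratio_neq0 x : positive x -> epsv C i x / phiv C i x != 0.
Proof. by move=> x0; rewrite gt_eqF // divr_gt0 // ?epsv_gt0 ?phiv_gt0. Qed.

(** Induction over the factors: in the factor l the incoming matrix determines,
    by uniqueness of the Gauss decomposition, the new Lax matrix (hence the new
    point) and the matrix passed on to the factor l + 1. *)
Lemma transports_inj W p q r : positive q -> positive r ->
  transports W p q -> transports W p r -> q = r.
Proof.
move=> q0 r0 [X [XW uX Xl]] [X' [X'W uX' X'l]].
have step (l : 'I_L) : X l = X' l ->
    F (factor q l) = F (factor r l) /\ X l.+1 = X' l.+1.
  move=> XX'; have [[k k0 kE] _] := Xl l; have [[k' _ k'E] _] := X'l l.
  apply: (@lower_upper_mx_inj _ k k') => //; first exact: lax_ratio_neq0 (positive_factor l q0).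
  by rewrite -/(F _) -/(F _) -kE -k'E XX'.
have XX' m : (m <= L)%N -> X m = X' m.
  elim: m => [|m IHm] mL; first by rewrite XW X'W.
  by have [_] := step (Ordinal mL) (IHm (ltnW mL)).
apply: factor_inj => l; apply: (lax_inj laxC); try exact: positive_factor.
  by have [] := step l (XX' _ (ltnW (ltn_ord l))).
by have [_ <-] := Xl l; have [_ <-] := X'l l.
Qed.

Lemma transports_id p : transports 1%:M p p.
Proof.
exists (fun=> 1%:M); split=> // [m|l]; first by exists 0, 0, 0; rewrite upper_mx0.
by split=> //; exists 1; rewrite ?oner_neq0 // scale1r mul1mx mulmx1.
Qed.

(** The matrices passed along are the shears attached to the parameters c_l. *)
Lemma transports_actv b c p : 0 < c -> positive p ->
  transports (shear_mx b ((c - 1) / epsv D (nd b) p)) p (actv D (nd b) c p).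
Proof.
move=> c0 p0; pose u := shear (epsf C (nd b) p) (phif C (nd b) p) c.
have e0 l : 0 < epsf C (nd b) p l by apply: epsf_gt0.
have f0 l : 0 < phif C (nd b) p l by apply: phif_gt0.
exists (fun m => shear_mx b (u m)); split=> [|m|l].
- by rewrite /u shear0 epsv_prod.
- exact: unitri_shear_mx.
have pl0 := factor_param_at_gt0 L_gt0 posC (nd b) l c0 p0.
rewrite factor_actv // (inv_actv laxC) //; last exact: positive_factor.
split=> //; set d := factor_param _ _ c l in pl0 *.
exists (if b then d else 1); first by case: (b); rewrite gt_eqF.
rewrite /u shear_left // shear_right // (lax_actv laxC) //.
exact: positive_factor.
Qed.

Definition monodromy p : 'M[R]_3 := \prod_(l < L) F (factor p l).
Definition Etot p : R := monodromy p i2 i0.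

(** So the monodromy matrix has the shape of a Lax matrix for the product. *)
Lemma monodromyE p : positive p ->
  monodromy p = lower_mx (epsv D i p) (\prod_(l < L) (epsf C i p l / phif C i p l))
    (epsv D j p) (\prod_(l < L) (epsf C j p l / phif C j p l)) (Etot p).
Proof.
move=> p0.
have [|E' mE] := @prod_lower_mx _ L (epsf C i p) (phif C i p) (epsf C j p) (phif C j p)
  (fun l => E (factor p l)).
  by move=> l; apply: lax_ratio_neq0; apply: positive_factor.
rewrite !epsv_prod //.
suff -> : Etot p = E' by [].
by rewrite /Etot /monodromy mE mxE.
Qed.

Lemma transports_monodromy W p q : transports W p q ->
  exists k V, [/\ k != 0, unitri V & W *m monodromy p = k *: (monodromy q *m V)].
Proof.
move=> [X [<- uX Xl]].
have [|k k0 kE] := @telescope_prod_mx _ _ _ (fun l => F (factor p l)) (fun l => F (factor q l)) X.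
  by move=> l; have [] := Xl l.
by exists k, (X L).
Qed.

Lemma ratio_prod_neq0 p : positive p ->
  \prod_(l < L) (epsf C i p l / phif C i p l) != 0.
Proof.
by move=> p0; apply/prodf_neq0 => l _; apply: lax_ratio_neq0; apply: positive_factor.
Qed.

(** The exchange relation of the monodromy matrix gives the new values of
    eps_i, eps_j and E, the only data that enter the braid relation. *)
Lemma actv_first c p : 0 < c -> positive p ->
  let q := actv D i c p in
  [/\ epsv D i q = epsv D i p / c, Etot q = Etot p / c &
      epsv D j q = c * epsv D j p - (c - 1) * Etot p / epsv D i p].
Proof.
move=> c0 p0 q; have q0 : positive q by apply: actv_gt0.
have e0 : epsv D i p != 0 by rewrite gt_eqF ?epsv_gt0.
have [k [W [k0 uW]]] := transports_monodromy (transports_actv true c0 p0).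
rewrite (monodromyE p0) (monodromyE (q0 : positive (actv D (nd true) c p))).
case/shear_first_row => //; first exact: ratio_prod_neq0.
rewrite /= divfK // addrC subrK -/q => -> eE EE hE.
have c0' : c != 0 by rewrite gt_eqF.
split; last by rewrite hE mulrAC.
- by apply: (mulfI c0'); rewrite -eE mulrC divfK.
by apply: (mulfI c0'); rewrite -EE mulrC divfK.
Qed.

Lemma actv_second c p : 0 < c -> positive p ->
  let q := actv D j c p in
  [/\ epsv D j q = epsv D j p / c, Etot q = Etot p &
      epsv D i q = epsv D i p + (c - 1) * Etot p / epsv D j p].
Proof.
move=> c0 p0 q; have q0 : positive q by apply: actv_gt0.
have e0 : epsv D j p != 0 by rewrite gt_eqF ?epsv_gt0.
have [k [W [k0 uW]]] := transports_monodromy (transports_actv false c0 p0).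
rewrite (monodromyE p0) (monodromyE (q0 : positive (actv D (nd false) c p))).
case/shear_second_row => //; first exact: ratio_prod_neq0.
rewrite /= divfK // [1 + _]addrC subrK -/q => _ eE EE hE.
have c0' : c != 0 by rewrite gt_eqF.
split; last by rewrite eE mulrAC.
  by apply: (mulfI c0'); rewrite -hE mulrC divfK.
by [].
Qed.

Lemma epsv_actv b c p : 0 < c -> positive p ->
  epsv D (nd b) (actv D (nd b) c p) = epsv D (nd b) p / c.
Proof.
by move=> c0 p0; case: b; [have [] := actv_first c0 p0|have [] := actv_second c0 p0].
Qed.

(** The incoming shears add up: (c - 1) d / eps + (d - 1) / eps = (c d - 1) / eps. *)
Lemma actv_mul b c d p : 0 < c -> 0 < d -> positive p ->
  actv D (nd b) c (actv D (nd b) d p) = actv D (nd b) (c * d) p.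
Proof.
move=> c0 d0 p0; have q0 := actv_gt0 posD (nd b) d0 p0.
have cd0 : 0 < c * d by rewrite mulr_gt0.
have e0 : epsv D (nd b) p != 0 by rewrite gt_eqF ?epsv_gt0.
have := transports_comp (transports_actv b d0 p0) (transports_actv b c0 q0).
rewrite mul_shear_mx epsv_actv //.
have -> : (c - 1) / (epsv D (nd b) p / d) + (d - 1) / epsv D (nd b) p =
          (c * d - 1) / epsv D (nd b) p.
  by field; rewrite e0 gt_eqF.
move=> m; apply: transports_inj m (transports_actv b cd0 p0); exact: actv_gt0.
Qed.

Lemma actv1 b p : positive p -> actv D (nd b) 1 p = p.
Proof.
move=> p0; have := transports_actv b ltr01 p0.
rewrite subrr mul0r shear_mx0 => m.
by apply: transports_inj m (transports_id p) => //; apply: actv_gt0 => //; apply: ltr01.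
Qed.

(** Both sides transport a product of three shears through the point p, and the
    two products are the same unitriangular matrix. *)
Lemma actv_braid c d p : 0 < c -> 0 < d -> positive p ->
  actv D i c (actv D j (c * d) (actv D i d p)) =
  actv D j d (actv D i (c * d) (actv D j c p)).
Proof.
move=> c0 d0 p0; have cd0 : 0 < c * d by rewrite mulr_gt0.
have p1 := actv_gt0 posD i d0 p0; have p2 := actv_gt0 posD j cd0 p1.
have p3 := actv_gt0 posD i c0 p2.
have q1 := actv_gt0 posD j c0 p0; have q2 := actv_gt0 posD i cd0 q1.
have q3 := actv_gt0 posD j d0 q2.
have mp := transports_comp (transports_actv true d0 p0)
  (transports_comp (transports_actv false cd0 p1) (transports_actv true c0 p2)).
have mq := transports_comp (transports_actv false c0 p0)
  (transports_comp (transports_actv true cd0 q1) (transports_actv false d0 q2)).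
apply: transports_inj (mp) _; rewrite //=.
suff -> : shear_mx true ((c - 1) / epsv D i (actv D j (c * d) (actv D i d p))) *m
    shear_mx false ((c * d - 1) / epsv D j (actv D i d p)) *m
    shear_mx true ((d - 1) / epsv D i p) =
  shear_mx false ((d - 1) / epsv D j (actv D i (c * d) (actv D j c p))) *m
    shear_mx true ((c * d - 1) / epsv D i (actv D j c p)) *m
    shear_mx false ((c - 1) / epsv D j p) by exact: mq.
have [ei1 E1 ej1] := actv_first d0 p0; have [ej2 E2 ei2] := actv_second cd0 p1.
have [ej1' E1' ei1'] := actv_second c0 p0; have [ei2' E2' ej2'] := actv_first cd0 q1.
have h1 := epsv_gt0 posD j p1; have h2 := epsv_gt0 posD i p2.
have k1 := epsv_gt0 posD i q1; have k2 := epsv_gt0 posD j q2.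
have ei := epsv_gt0 posD i p0; have ej := epsv_gt0 posD j p0.
rewrite /= !mul_upper_mx.
rewrite ei2 E1 ej1 ei1 in h2 *; rewrite ej1 in h1 *.
rewrite ej2' E1' ei1' ej1' in k2 *; rewrite ei1' in k1 *.
move: (epsv D i p) (epsv D j p) (Etot p) => a b E0 in h1 h2 k1 k2 ei ej *.
(* The two expressions H = d a b - (d - 1) E0 and K = a b + (c - 1) E0, up to
   factors a, b, c, d, are the values of eps_j and eps_i after the first step;
   the values after the second step are a K / H and b H / K. *)
have hE : d * b - (d - 1) * E0 / a = (d * a * b - (d - 1) * E0) / a.
  by field; rewrite gt_eqF.
have kE : a + (c - 1) * E0 / b = (a * b + (c - 1) * E0) / b.
  by field; rewrite gt_eqF.
rewrite hE in h1 *; rewrite kE in k1 *.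
have H0 : d * a * b - (d - 1) * E0 != 0.
  by apply: contraTneq h1 => ->; rewrite mul0r ltxx.
have K0 : a * b + (c - 1) * E0 != 0.
  by apply: contraTneq k1 => ->; rewrite mul0r ltxx.
move: (lt0r_neq0 ei) (lt0r_neq0 ej) (lt0r_neq0 c0) (lt0r_neq0 d0) => a0 b0 c0' d0'.
have -> : a / d + (c * d - 1) * (E0 / d) / ((d * a * b - (d - 1) * E0) / a) =
    a * (a * b + (c - 1) * E0) / (d * a * b - (d - 1) * E0).
  by field; rewrite a0 d0' H0.
have -> : c * d * (b / c) - (c * d - 1) * E0 / ((a * b + (c - 1) * E0) / b) =
    b * (d * a * b - (d - 1) * E0) / (a * b + (c - 1) * E0).
  by field; rewrite b0 c0' K0.
by congr upper_mx; field; rewrite ?a0 ?b0 ?H0 ?K0.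
Qed.

End LaxPair.

(** * Products of crystals with Lax matrices *)
Section ProductCrystal.
Variables (R : realFieldType) (I : Type) (V : finType).
Variables (C : crystal_data R I V) (A : I -> I -> int) (L : nat).
Hypothesis L_gt0 : (0 < L)%N.
Hypothesis posC : positive_crystal C.
Local Notation PV := (('I_L * V)%type : finType).
Local Notation D := (crystal_prod L C).
Implicit Types (c d : R) (x : {ffun V -> R}) (p : {ffun PV -> R}).

Definition has_lax_pair (i j : I) :=
  exists E (T : Type) (inv : {ffun V -> R} -> T), lax_pair C i j E inv.

Definition invariant_under (i j : I) := forall c x, 0 < c -> positive x ->
  epsv C i (actv C j c x) = epsv C i x /\ phiv C i (actv C j c x) = phiv C i x.

Hypothesis gammaC : forall i j c x, 0 < c -> positive x ->
  phiv C i (actv C j c x) / epsv C i (actv C j c x) =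
  c ^ A i j * (phiv C i x / epsv C i x).
Hypothesis A_diag : forall i, A i i = 2.
Hypothesis laxC : forall i, exists j k b, i = node j k b /\ has_lax_pair j k.
Hypothesis lax_adj : forall i j, A i j = -1 -> has_lax_pair i j \/ has_lax_pair j i.
Hypothesis inv_comm : forall i j, A i j = 0 ->
  [/\ invariant_under i j, invariant_under j i &
    forall c d x, 0 < c -> 0 < d -> positive x ->
      actv C i c (actv C j d x) = actv C j d (actv C i c x)].

Let posD : positive_crystal D := positive_crystal_prod L_gt0 posC.

Lemma gamma_prodE i p : positive p ->
  phiv D i p / epsv D i p = \prod_(l < L) (phif C i p l / epsf C i p l).
Proof.
move=> p0; rewrite phiv_prod // epsv_prod // /phi_total mulrAC divff ?mul1r //.
rewrite gt_eqF // eps_total_gt0 // => l; [exact: epsf_gt0|exact: phif_gt0].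
Qed.

(** gamma_i of the product is the product of the gamma_i of the factors, and
    the parameters c_l multiply to c. *)
Lemma gamma_prod_actv i j c p : 0 < c -> positive p ->
  phiv D i (actv D j c p) / epsv D i (actv D j c p) =
  c ^ A i j * (phiv D i p / epsv D i p).
Proof.
move=> c0 p0; have q0 := actv_gt0 posD j c0 p0; rewrite !gamma_prodE //.
pose d := factor_param (epsf C j p) (phif C j p) c.
have cE : \prod_(l < L) d l = c.
  by apply: prod_factor_param => // l; [apply: epsf_gt0|apply: phif_gt0].
have -> : c ^ A i j = \prod_(l < L) d l ^ A i j.
  rewrite -[in LHS]cE; elim/big_rec2: _ => [|l y z _ <-]; first exact: exp1rz.
  exact: expfzMl.
rewrite -big_split; apply: eq_bigr => l _ /=.
rewrite /phif /epsf factor_actv // gammaC //.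
  exact: factor_param_at_gt0.
exact: positive_factor.
Qed.

(** The parameters of e_i depend only on eps_i and phi_i of the factors, which a
    commuting node does not change. *)
Lemma factor_param_invariant i j c d p (l : 'I_L) : invariant_under i j ->
  0 < c -> 0 < d -> positive p ->
  let q := actv D j d p in
  factor_param (epsf C i q) (phif C i q) c l = factor_param (epsf C i p) (phif C i p) c l.
Proof.
move=> inv c0 d0 p0 q.
have inv_l k : epsf C i q k = epsf C i p k /\ phif C i q k = phif C i p k.
  rewrite /epsf /phif /q factor_actv //; apply: inv; first exact: factor_param_at_gt0.
  exact: positive_factor.
have gE m : weight (epsf C i q) (phif C i q) m = weight (epsf C i p) (phif C i p) m.
  by apply: eq_bigr => k _; have [-> ->] := inv_l k.
have nE m : deformed_sum (epsf C i q) (phif C i q) c m = deformed_sum (epsf C i p) (phif C i p) c m.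
  by apply: eq_bigr => k _; rewrite /summand gE; have [-> _] := inv_l k.
by rewrite /factor_param !nE.
Qed.

Lemma actv_prod_comm i j c d p : A i j = 0 -> 0 < c -> 0 < d -> positive p ->
  actv D i c (actv D j d p) = actv D j d (actv D i c p).
Proof.
move=> /inv_comm[iij iji com] c0 d0 p0; apply: factor_inj => l.
have pj := actv_gt0 posD j d0 p0; have pi := actv_gt0 posD i c0 p0.
rewrite [LHS]factor_actv // [RHS]factor_actv // !factor_param_invariant //.
rewrite [in LHS]factor_actv // [in RHS]factor_actv //.
by apply: com; [exact: factor_param_at_gt0|exact: factor_param_at_gt0|exact: positive_factor].
Qed.

(** The scaling of phi_i is deduced from those of eps_i and gamma_i. *)
Lemma geometric_crystal_prod : geometric_crystal A D.
Proof.
have eps_act i c p : 0 < c -> positive p ->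
    epsv D i (actv D i c p) = c^-1 * epsv D i p.
  have [j [k [b [-> [E [T [inv lax]]]]]]] := laxC i.
  by move=> c0 p0; rewrite (epsv_actv L_gt0 posC lax) // mulrC.
apply: (geometric_crystal_of_positive posD) => //.
- move=> i; have [j [k [b [-> [E [T [inv lax]]]]]]] := laxC i => c d p c0 d0 p0.
  exact: (actv_mul L_gt0 posC lax).
- move=> i; have [j [k [b [-> [E [T [inv lax]]]]]]] := laxC i => p p0.
  exact: (actv1 L_gt0 posC lax).
- move=> i c p c0 p0; have q0 := actv_gt0 posD i c0 p0.
  have e0 (y : {ffun PV -> R}) : positive y -> epsv D i y != 0.
    by move=> y0; rewrite gt_eqF ?epsv_gt0.
  rewrite -[LHS](divfK (e0 _ q0)) gamma_prod_actv // eps_act // A_diag.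
  by rewrite -exprnP; field; rewrite e0 // gt_eqF.
- by move=> *; apply: gamma_prod_actv.
- by move=> *; apply: actv_prod_comm.
move=> i j c d p Aij _ c0 d0 p0.
have [[E [T [inv lax]]]|[E [T [inv lax]]]] := lax_adj Aij.
  exact: (actv_braid L_gt0 posC lax).
by rewrite mulrC -(actv_braid L_gt0 posC lax).
Qed.

End ProductCrystal.

(** * Subtraction-free expressions *)
Section SubtractionFree.
Variables (R : realFieldType) (V : Type).

Fixpoint subtraction_free (t : ratexp R V) : bool :=
  match t with
  | RVar _ => true
  | RConst r => 0 < r
  | RAdd a b | RMul a b => subtraction_free a && subtraction_free b
  | ROpp _ => false
  | RInv a => subtraction_free a
  end.

Lemma pdef_subtraction_free (p : V -> R) t :
  positive p -> subtraction_free t -> pdef p t.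
Proof.
move=> p0; rewrite /pdef; elim: t => //=.
- by move=> a IHa b IHb /andP[/IHa/andP[-> a0] /IHb/andP[-> b0]]; rewrite addr_gt0.
- by move=> a IHa b IHb /andP[/IHa/andP[-> a0] /IHb/andP[-> b0]]; rewrite mulr_gt0.
by move=> a IHa /IHa/andP[-> a0]; rewrite invr_gt0 a0 gt_eqF.
Qed.

End SubtractionFree.

(** * Local coordinates at an adjacent pair *)
Section LocalCoordinates.
Variables (R : realFieldType) (I : Type) (V : finType).
Variables (C : crystal_data R I V) (i j : I).
Implicit Types (c : R) (x y : {ffun V -> R}).

(** The common form of the type D crystal near adjacent nodes i, j. The node i
    moves two pairs of variables (X1, B1), (X2, B2), in the way in which e_1
    moves (x_1, bar x_1), (x_2, bar x_2). The node j moves X2 and B2, and the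
    remaining factors t, t' of eps_j = B2 t and phi_j = X2 t'; the positive
    number s describes how the factor c of phi_j is shared between X2 and t', and
    the factor 1/c of eps_j between B2 and t. *)
Record local_pair (X1 B1 X2 B2 t t' : {ffun V -> R} -> R) (T : Type)
    (inv : {ffun V -> R} -> T) : Prop := LocalPair {
  lp_gt0 : forall x, positive x ->
    [/\ 0 < X1 x, 0 < B1 x & 0 < X2 x] /\ [/\ 0 < B2 x, 0 < t x & 0 < t' x];
  lp_first : forall x, epsv C i x = B1 x * (X2 x / B2 x + 1) /\
                       phiv C i x = X1 x * (B2 x / X2 x + 1);
  lp_second : forall x, epsv C j x = B2 x * t x /\ phiv C j x = X2 x * t' x;
  lp_act_first : forall c x, 0 < c -> positive x ->
    let y := actv C i c x in
    let xi_low := (X2 x + c * B2 x) / (X2 x + B2 x) in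
    [/\ X1 y = c * xi_low^-1 * X1 x, B1 y = xi_low^-1 * B1 x,
        X2 y = c^-1 * xi_low * X2 x & B2 y = xi_low * B2 x] /\
    [/\ t y = t x, t' y = t' x & inv y = inv x];
  lp_act_second : forall c x, 0 < c -> positive x ->
    let y := actv C j c x in
    exists2 s, 0 < s & [/\ X1 y = X1 x, B1 y = B1 x, X2 y = c * s * X2 x &
      B2 y = s * B2 x] /\ [/\ t y = t x / (c * s), t' y = t' x / s & inv y = inv x];
  lp_inj : forall x y, positive x -> positive y ->
    [/\ X1 x = X1 y, B1 x = B1 y & X2 x / B2 x = X2 y / B2 y] ->
    B2 x * t x = B2 y * t y -> X2 x * t' x = X2 y * t' y -> inv x = inv y -> x = y
}.

Variables (X1 B1 X2 B2 t t' : {ffun V -> R} -> R).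
Variables (T : Type) (inv : {ffun V -> R} -> T).
Hypothesis lp : local_pair X1 B1 X2 B2 t t' inv.

(** The choice E = B1 X2 t is forced by the exchange relation for e_i. The Lax
    matrix determines B1 = eps_i - E / eps_j, then X2 / B2 from E / eps_j =
    B1 X2 / B2, then X1 from eps_i / phi_i; [lp_inj] takes over from there. *)
Lemma lax_pair_of_local : lax_pair C i j (fun x => B1 x * X2 x * t x) inv.
Proof.
split.
- move=> b c x c0 x0; have [[X10 B10 X20] [B20 t0 t'0]] := lp_gt0 lp x0.
  have XB0 : 0 < X2 x + B2 x by rewrite addr_gt0.
  have BX0 : 0 < B2 x + X2 x by rewrite addr_gt0.
  have BcX0 : 0 < B2 x + c * X2 x by rewrite addr_gt0 ?mulr_gt0.
  have XcB0 : 0 < X2 x + c * B2 x by rewrite addr_gt0 ?mulr_gt0.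
  have [ei fi] := lp_first lp x; have [ej fj] := lp_second lp x.
  rewrite /lax; case: b; rewrite /node /shear_mx mul_upper_lower_mx scale_lower_upper_mx.
  + have [[y1 y2 y3 y4] [y5 y6 _]] := lp_act_first lp c0 x0.
    have [ei' fi'] := lp_first lp (actv C i c x).
    have [ej' fj'] := lp_second lp (actv C i c x).
    rewrite ei' fi' ej' fj' ei fi ej fj y1 y2 y3 y4 y5 y6.
    by congr (mx3 [:: [:: _; _; _]; [:: _; _; _]; [:: _; _; _]]); field;
      rewrite !gt_eqF.
  have [s s0 [[y1 y2 y3 y4] [y5 y6 _]]] := lp_act_second lp c0 x0.
  have [ei' fi'] := lp_first lp (actv C j c x).
  have [ej' fj'] := lp_second lp (actv C j c x).
  rewrite ei' fi' ej' fj' ei fi ej fj y1 y2 y3 y4 y5 y6.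
  by congr (mx3 [:: [:: _; _; _]; [:: _; _; _]; [:: _; _; _]]); field;
    rewrite !gt_eqF.
- move=> [] c x c0 x0; first by have [_ []] := lp_act_first lp c0 x0.
  by have [s _ [_ []]] := lp_act_second lp c0 x0.
move=> x y x0 y0 /mx3_inj[_ [ee ea _] [eE eh ed]] einv.
have [[X10 B10 X20] [B20 t0 t'0]] := lp_gt0 lp x0.
have [[X10' B10' X20'] [B20' t0' t'0']] := lp_gt0 lp y0.
have [ei fi] := lp_first lp x; have [ej fj] := lp_second lp x.
have [ei' fi'] := lp_first lp y; have [ej' fj'] := lp_second lp y.
have BX0 : 0 < B2 x + X2 x by rewrite addr_gt0.
have BX0' : 0 < B2 y + X2 y by rewrite addr_gt0.
have XB0 : 0 < X2 x + B2 x by rewrite addr_gt0.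
have XB0' : 0 < X2 y + B2 y by rewrite addr_gt0.
have a0 : epsv C i x / phiv C i x != 0.
  by rewrite ei fi gt_eqF // !(divr_gt0, mulr_gt0, addr_gt0).
have hh : epsv C j x = epsv C j y.
  by apply: (mulfI a0); rewrite eh -ea.
have dd : epsv C j x / phiv C j x = epsv C j y / phiv C j y.
  by apply: (mulfI a0); rewrite ed -ea.
have Br : B1 x * (X2 x / B2 x) = B1 y * (X2 y / B2 y).
  have -> : B1 x * (X2 x / B2 x) = B1 x * X2 x * t x / epsv C j x.
    by rewrite ej; field; rewrite !gt_eqF.
  by rewrite eE hh ej'; field; rewrite !gt_eqF.
have Be : B1 x = B1 y.
  have -> : B1 x = epsv C i x - B1 x * (X2 x / B2 x) by rewrite ei; ring.
  by rewrite ee Br ei'; ring.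
have re : X2 x / B2 x = X2 y / B2 y.
  by apply: (mulfI (lt0r_neq0 B10)); rewrite Br Be.
have Xe : X1 x = X1 y.
  have -> : X1 x = B1 x * (X2 x / B2 x) / (epsv C i x / phiv C i x).
    by rewrite ei fi; field; rewrite !gt_eqF.
  by rewrite Br ea ei' fi'; field; rewrite !gt_eqF.
apply: (lp_inj lp) => //; first by rewrite -ej -ej'.
rewrite -fj -fj'; apply: (mulfI (_ : epsv C j x / phiv C j x != 0)).
  by rewrite ej fj gt_eqF // !(divr_gt0, mulr_gt0).
have e0 : epsv C j x != 0 by rewrite ej gt_eqF // mulr_gt0.
have f0 y' : positive y' -> phiv C j y' != 0.
  move=> /(lp_gt0 lp)[[_ _ ?] [_ _ ?]]; have [_ ->] := lp_second lp y'.
  by rewrite gt_eqF // mulr_gt0.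
by rewrite divfK ?f0 // dd divfK ?f0.
Qed.

Definition gamma_scaled (k l : I) (a : int) := forall c x, 0 < c -> positive x ->
  phiv C k (actv C l c x) / epsv C k (actv C l c x) =
  c ^ a * (phiv C k x / epsv C k x).

Lemma gamma_of_local :
  [/\ gamma_scaled i i 2, gamma_scaled j j 2, gamma_scaled i j (-1) &
      gamma_scaled j i (-1)].
Proof.
split=> c x c0 x0; have [[X10 B10 X20] [B20 t0 t'0]] := lp_gt0 lp x0;
have [ei fi] := lp_first lp x; have [ej fj] := lp_second lp x;
(have XB0 : 0 < X2 x + B2 x by rewrite addr_gt0);
(have BX0 : 0 < B2 x + X2 x by rewrite addr_gt0);
(have XcB0 : 0 < X2 x + c * B2 x by rewrite addr_gt0 ?mulr_gt0);
(have BcX0 : 0 < B2 x + c * X2 x by rewrite addr_gt0 ?mulr_gt0);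
(have cXB0 : 0 < c * X2 x + B2 x by rewrite addr_gt0 ?mulr_gt0).
- have [[y1 y2 y3 y4] [y5 y6 _]] := lp_act_first lp c0 x0.
  have [ei' fi'] := lp_first lp (actv C i c x).
  rewrite ei' fi' ei fi y1 y2 y3 y4 -exprnP; field; rewrite !gt_eqF //.
- have [s s0 [[y1 y2 y3 y4] [y5 y6 _]]] := lp_act_second lp c0 x0.
  have [ej' fj'] := lp_second lp (actv C j c x).
  by rewrite ej' fj' ej fj y3 y4 y5 y6 -exprnP; field; rewrite !gt_eqF.
- have [s s0 [[y1 y2 y3 y4] [y5 y6 _]]] := lp_act_second lp c0 x0.
  have [ei' fi'] := lp_first lp (actv C j c x).
  by rewrite ei' fi' ei fi y1 y2 y3 y4 exprN1; field; rewrite !gt_eqF.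
have [[y1 y2 y3 y4] [y5 y6 _]] := lp_act_first lp c0 x0.
have [ej' fj'] := lp_second lp (actv C i c x).
by rewrite ej' fj' ej fj y3 y4 y5 y6 exprN1; field; rewrite !gt_eqF.
Qed.

End LocalCoordinates.

(** * The crystal of type D *)
Section TypeDCrystal.
Variables (R : realFieldType) (n : nat).
Hypothesis n_ge4 : (4 <= n)%N.
Local Notation C := (crystalD n R).
Local Notation xv := (xvar n).
Local Notation bv := (bvar n).
Implicit Types (i j : 'I_n.+1) (k m : nat) (c d : R) (x y : {ffun varD n -> R}).

(** The index k of the variables x_k and bar x_k. *)
Definition level (v : varD n) : nat :=
  match v with inl k => k.+1 | inr k => k.+1 end.

Lemma level_xv k : (1 <= k <= n)%N -> level (xv k) = k.
Proof. by move=> kn; rewrite /= inordK; lia. Qed.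

Lemma level_bv k : (1 <= k <= n - 1)%N -> level (bv k) = k.
Proof. by move=> kn; rewrite /= inordK; lia. Qed.

Lemma xv_eq k m : (1 <= k <= n)%N -> (1 <= m <= n)%N -> (xv k == xv m) = (k == m).
Proof.
move=> kn mn; apply/eqP/eqP => [/(congr1 level)|->//].
by rewrite !level_xv.
Qed.

Lemma bv_eq k m : (1 <= k <= n - 1)%N -> (1 <= m <= n - 1)%N ->
  (bv k == bv m) = (k == m).
Proof.
move=> kn mn; apply/eqP/eqP => [/(congr1 level)|->//].
by rewrite !level_bv.
Qed.

(** For 1 <= i <= n - 2 the map e_i moves two variables of level i and two of
    level i + 1. The node 0 acts like the node 1 with x_1 and bar x_1 exchanged; the
    functions [vX], [vB], [vX'], [vB'] name the moved variables so as to treat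
    both cases at once. *)
Definition nxt i : nat := if i == 0%N :> nat then 2 else i.+1.
Definition vX i : varD n := if i == 0%N :> nat then bv 1 else xv i.
Definition vB i : varD n := if i == 0%N :> nat then xv 1 else bv i.
Definition vX' i : varD n := xv (nxt i).
Definition vB' i : varD n := bv (nxt i).

Lemma positive_crystalD : positive_crystal C.
Proof.
have oneP : (0 : R) < 1 := ltr01.
split=> [i x x0|i x x0|i c x v c0 x0].
- apply: (pdef_subtraction_free x0); rewrite /= /epsD.
  by do 3?case: ifP => _ //=; rewrite oneP.
- apply: (pdef_subtraction_free x0); rewrite /= /phiD.
  by do 3?case: ifP => _ //=; rewrite oneP.
apply: pdef_subtraction_free; first by case.
by rewrite /= /actD; do 7?case: ifP => _ //=.
Qed.

Section Low.
Variable i : 'I_n.+1.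
Hypothesis i_low : (i <= n - 2)%N.

Lemma epsv_low x : epsv C i x = x (vB i) * (x (vX' i) / x (vB' i) + 1).
Proof. by rewrite /epsv /= /epsD i_low /vB /vX' /vB' /nxt; case: eqP. Qed.

Lemma phiv_low x : phiv C i x = x (vX i) * (x (vB' i) / x (vX' i) + 1).
Proof. by rewrite /phiv /= /phiD i_low /vX /vX' /vB' /nxt; case: eqP. Qed.

Definition xi_low c x := (x (vX' i) + c * x (vB' i)) / (x (vX' i) + x (vB' i)).

Lemma actv_low c x v : actv C i c x v =
  if v == vX i then c * (xi_low c x)^-1 * x (vX i)
  else if v == vB i then (xi_low c x)^-1 * x (vB i)
  else if v == vX' i then c^-1 * xi_low c x * x (vX' i)
  else if v == vB' i then xi_low c x * x (vB' i)
  else x v.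
Proof.
rewrite ffunE /= /actD /xi_low /vX /vB /vX' /vB' /nxt i_low.
case: eqP => [i0|/eqP i0].
  have x12 : (xv 1 == xv 2) = false by rewrite xv_eq //; lia.
  have b12 : (bv 1 == bv 2) = false by rewrite bv_eq //; lia.
  have [->|_] := eqVneq v (xv 1); first by [].
  have [->|_] := eqVneq v (xv 2); first by [].
  have [->|_] := eqVneq v (bv 2); first by rewrite eq_sym b12.
  by case: (eqVneq v (bv 1)).
have xii : (xv i.+1 == xv i) = false by rewrite xv_eq //; lia.
have bii : (bv i == bv i.+1) = false by rewrite bv_eq //; lia.
have [_|_] := eqVneq v (xv i); first by [].
have [->|_] := eqVneq v (xv i.+1); first by [].
have [->|_] := eqVneq v (bv i.+1); first by rewrite eq_sym bii.
by case: (eqVneq v (bv i)).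
Qed.
End Low.

Lemma epsv_penult i x : i = (n - 1)%N :> nat ->
  epsv C i x = x (xv n) * x (bv (n - 1)).
Proof.
move=> iE; rewrite /epsv /= /epsD iE eqxx !ifF //; lia.
Qed.

Lemma phiv_penult i x : i = (n - 1)%N :> nat -> phiv C i x = x (xv (n - 1)).
Proof.
move=> iE; rewrite /phiv /= /phiD iE eqxx !ifF //; lia.
Qed.

Lemma actv_penult i c x v : i = (n - 1)%N :> nat -> actv C i c x v =
  if v == xv (n - 1) then c * x (xv (n - 1))
  else if v == xv n then c^-1 * x (xv n) else x v.
Proof.
move=> iE; rewrite ffunE /= /actD iE eqxx.
have -> : (n - 1 == 0)%N = false by lia.
have -> : (n - 1 <= n - 2)%N = false by lia.
by case: ifP => //; case: ifP.
Qed.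

Lemma epsv_last i x : i = n :> nat -> epsv C i x = x (bv (n - 1)).
Proof. move=> iE; rewrite /epsv /= /epsD iE !ifF //; lia. Qed.

Lemma phiv_last i x : i = n :> nat -> phiv C i x = x (xv (n - 1)) * x (xv n).
Proof. move=> iE; rewrite /phiv /= /phiD iE !ifF //; lia. Qed.

Lemma actv_last i c x v : i = n :> nat -> actv C i c x v =
  if v == xv n then c * x (xv n)
  else if v == bv (n - 1) then c^-1 * x (bv (n - 1)) else x v.
Proof.
move=> iE; rewrite ffunE /= /actD iE.
have -> : (n == 0)%N = false by lia.
have -> : (n <= n - 2)%N = false by lia.
have -> : (n == n - 1)%N = false by lia.
by case: ifP => //; case: ifP.
Qed.

(** The variables seen or moved by e_i, eps_i and phi_i are exactly those of the
    levels [lowest i] and [lowest i] + 1. *)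
Definition lowest i : nat :=
  if i == 0%N :> nat then 1%N else if (i <= n - 2)%N then i : nat else (n - 1)%N.

Lemma level_low i : (i <= n - 2)%N ->
  [/\ level (vX i) = lowest i, level (vB i) = lowest i,
      level (vX' i) = (lowest i).+1 & level (vB' i) = (lowest i).+1].
Proof.
move=> il; rewrite /lowest il /vX /vB /vX' /vB' /nxt; case: eqP => i0;
by rewrite !level_xv ?level_bv //; lia.
Qed.

Lemma actv_out i c x v : ~~ (lowest i <= level v <= (lowest i).+1)%N ->
  actv C i c x v = x v.
Proof.
have [il|ih] := leqP i (n - 2).
  have [l1 l2 l3 l4] := level_low il => out.
  rewrite actv_low //; do ?case: eqP => [vE|_] //;
  by move: out; rewrite vE ?l1 ?l2 ?l3 ?l4 ?leqnn ?leqnSn.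
have -> : lowest i = (n - 1)%N by rewrite /lowest !ifF //; lia.
move=> out; have [iE|iE] : i = (n - 1)%N :> nat \/ i = n :> nat by have := ltn_ord i; lia.
  rewrite actv_penult //; do ?case: eqP => [vE|_] //;
  by move: out; rewrite vE level_xv; lia.
rewrite actv_last //; do ?case: eqP => [vE|_] //; move: out; rewrite vE.
  by rewrite level_xv; lia.
by rewrite level_bv; lia.
Qed.

Lemma actv_low_in i c x : (i <= n - 2)%N ->
  [/\ actv C i c x (vX i) = c * (xi_low i c x)^-1 * x (vX i),
      actv C i c x (vB i) = (xi_low i c x)^-1 * x (vB i),
      actv C i c x (vX' i) = c^-1 * xi_low i c x * x (vX' i) &
      actv C i c x (vB' i) = xi_low i c x * x (vB' i)].
Proof.
move=> il; have [l1 l2 l3 l4] := level_low il.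
have BX : (vB i == vX i) = false by rewrite /vB /vX; case: ifP.
have B'X' : (vB' i == vX' i) = false by [].
have X'X : (vX' i == vX i) = false by apply/eqP => /(congr1 level); lia.
have X'B : (vX' i == vB i) = false by apply/eqP => /(congr1 level); lia.
have B'X : (vB' i == vX i) = false by apply/eqP => /(congr1 level); lia.
have B'B : (vB' i == vB i) = false by apply/eqP => /(congr1 level); lia.
by rewrite !actv_low // !eqxx BX B'X' X'X X'B B'X B'B.
Qed.

(** The quotient of the second and third equations and the value of p / q give
    a / b, which then yields p and q; the last equation gives a b, and positivity
    selects the square root a of (a / b) (a b). *)
Lemma low_coords_inj (a b p q a' b' p' q' : R) :
  0 < a -> 0 < b -> 0 < p -> 0 < q -> 0 < a' -> 0 < b' -> 0 < p' -> 0 < q' ->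
  p / q = p' / q' -> q * (a / b + 1) = q' * (a' / b' + 1) ->
  p * (b / a + 1) = p' * (b' / a' + 1) -> p * q * a * b = p' * q' * a' * b' ->
  [/\ p = p', q = q', a = a' & b = b'].
Proof.
move=> a0 b0 p0 q0 a'0 b'0 p'0 q'0 r e f prod.
have ab0 : 0 < a + b by rewrite addr_gt0.
have ab'0 : 0 < a' + b' by rewrite addr_gt0.
have ba0 : 0 < b + a by rewrite addr_gt0.
have ba'0 : 0 < b' + a' by rewrite addr_gt0.
have s : a / b = a' / b'.
  have -> : a / b = (p / q) * (q * (a / b + 1)) / (p * (b / a + 1)).
    by field; rewrite !gt_eqF.
  by rewrite r e f; field; rewrite !gt_eqF.
have qE : q = q'.
  by apply: (mulIf (_ : a / b + 1 != 0)); rewrite ?gt_eqF ?addr_gt0 ?divr_gt0 // e s.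
have pE : p = p'.
  by rewrite -(divfK (lt0r_neq0 q0) p) r qE divfK // gt_eqF.
have abE : a * b = a' * b'.
  by apply: (mulfI (_ : p * q != 0)); rewrite ?gt_eqF ?mulr_gt0 // !mulrA prod pE qE.
have aE : a = a'.
  apply/eqP; rewrite -(@eqrXn2 _ 2) ?ltW //; apply/eqP.
  have -> : a ^+ 2 = (a / b) * (a * b) by field; rewrite gt_eqF.
  by rewrite s abE; field; rewrite gt_eqF.
by split=> //; apply: (mulfI (lt0r_neq0 a0)); rewrite abE aE.
Qed.

(** Forgets the variables in s; it serves as an invariant of maps that move only
    those variables. *)
Definition masked (s : seq (varD n)) x : {ffun varD n -> R} :=
  [ffun v => if v \in s then 1 else x v].

Lemma masked_inj s x y : masked s x = masked s y -> {in s, x =1 y} -> x = y.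
Proof.
move=> mxy sxy; apply/ffunP => v; have [/sxy //|vs] := boolP (v \in s).
by have /ffunP/(_ v) := mxy; rewrite !ffunE (negPf vs).
Qed.

Lemma masked_actv_low i s c x : (i <= n - 2)%N ->
  {subset [:: vX i; vB i; vX' i; vB' i] <= s} -> masked s (actv C i c x) = masked s x.
Proof.
move=> il sub; apply/ffunP => v; rewrite /masked ffunE [RHS]ffunE.
case: ifP => // vs; rewrite actv_low //.
by do 4!(case: eqP => [vE|_]; first by rewrite vE sub ?inE ?eqxx ?orbT in vs).
Qed.

(** The Lax matrix has five independent entries and the pair moves six
    variables; the sixth function is their product, which is invariant. *)
Lemma local_pair_low i j : (i <= n - 2)%N -> (j <= n - 2)%N -> j = nxt i :> nat ->
  local_pair C i j (fun x => x (vX i)) (fun x => x (vB i)) (fun x => x (vX j))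
    (fun x => x (vB j)) (fun x => x (vX' j) / x (vB' j) + 1)
    (fun x => x (vB' j) / x (vX' j) + 1)
    (fun x => (masked [:: vX i; vB i; vX j; vB j; vX' j; vB' j] x,
      x (vX i) * x (vB i) * (x (vX j) * x (vB j) * x (vX' j) * x (vB' j)))).
Proof.
move=> il jl jE.
have [l1 l2 l3 l4] := level_low il; have [k1 k2 k3 k4] := level_low jl.
have j0 : (j == 0%N :> nat) = false by rewrite jE /nxt; case: ifP.
have loE : lowest j = (lowest i).+1.
  by rewrite /lowest il jl j0 jE /nxt; case: ifP.
have XE : vX j = vX' i by rewrite /vX /vX' j0 jE.
have BE : vB j = vB' i by rewrite /vB /vB' j0 jE.
split.
- by move=> x x0; rewrite !x0 !addr_gt0 ?divr_gt0 ?x0.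
- by move=> x; rewrite epsv_low // phiv_low // XE BE.
- by move=> x; rewrite epsv_low // phiv_low.
- move=> c x c0 x0 y xi0.
  have XB0 : 0 < x (vX' i) + x (vB' i) by rewrite addr_gt0.
  have XcB0 : 0 < x (vX' i) + c * x (vB' i) by rewrite addr_gt0 ?mulr_gt0.
  have [yX yB yX' yB'] := actv_low_in c x il.
  have xiE : xi0 = xi_low i c x by rewrite /xi0 /xi_low XE BE.
  have yout v : level v = (lowest j).+1 -> y v = x v.
    by move=> lv; apply: actv_out; rewrite lv loE; lia.
  rewrite xiE XE BE /y yX yB yX' yB' !yout //; split=> //; split=> //.
  congr pair.
    apply: masked_actv_low => // v; rewrite !inE.
    by case/or4P => /eqP ->; rewrite eqxx ?orbT.
  by rewrite /xi_low; field; rewrite !gt_eqF.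
- move=> c x c0 x0 y.
  have XB0 : 0 < x (vX' j) + x (vB' j) by rewrite addr_gt0.
  have XcB0 : 0 < x (vX' j) + c * x (vB' j) by rewrite addr_gt0 ?mulr_gt0.
  have BcX0 : 0 < x (vB' j) + x (vX' j) by rewrite addr_gt0.
  have [yX yB yX' yB'] := actv_low_in c x jl.
  have yout v : level v = lowest i -> y v = x v.
    by move=> lv; apply: actv_out; rewrite lv loE; lia.
  have xi0 : 0 < xi_low j c x by rewrite divr_gt0.
  exists (xi_low j c x)^-1; first by rewrite invr_gt0.
  rewrite /y yX yB yX' yB' !yout //; split=> //; split.
  + by rewrite /xi_low; field; rewrite !gt_eqF.
  + by rewrite /xi_low; field; rewrite !gt_eqF.
  congr pair.
    apply: masked_actv_low => // v; rewrite !inE.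
    by case/or4P => /eqP ->; rewrite eqxx ?orbT.
  by rewrite /xi_low; field; rewrite !gt_eqF.
move=> x y x0 y0 [eX eB er] ee ef [em ep].
have [|pE qE aE bE] := low_coords_inj (x0 _) (x0 _) (x0 _) (x0 _)
  (y0 _) (y0 _) (y0 _) (y0 _) er ee ef.
  apply: (mulfI (_ : x (vX i) * x (vB i) != 0)); first by rewrite gt_eqF ?mulr_gt0.
  by rewrite ep eX eB.
apply: masked_inj em _ => v; rewrite !inE.
by do 6!(case: eqP => [-> //|_]).
Qed.

Lemma xv_penult_last : (xv (n - 1) == xv n) = false.
Proof. by rewrite xv_eq; lia. Qed.

(** At the end n - 2, n - 1, n of the diagram the pair moves only five variables,
    and the Lax matrix separates the points by itself. *)
Section Fork.
Variables i j : 'I_n.+1.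
Hypothesis iE : i = (n - 2)%N :> nat.
Let i_low : (i <= n - 2)%N. Proof. by rewrite iE. Qed.

Let X'E : vX' i = xv (n - 1).
Proof. by rewrite /vX' /nxt ifF; [congr xv; lia|lia]. Qed.

Let B'E : vB' i = bv (n - 1).
Proof. by rewrite /vB' /nxt ifF; [congr bv; lia|lia]. Qed.

Let lowE : lowest i = (n - 2)%N.
Proof. by rewrite /lowest i_low iE ifF //; lia. Qed.

Let masked_fork x := masked [:: vX i; vB i; vX' i; vB' i; xv n] x.

Let masked_fork_low c x : masked_fork (actv C i c x) = masked_fork x.
Proof.
apply: masked_actv_low => // v; rewrite !inE.
by case/or4P => /eqP ->; rewrite eqxx ?orbT.
Qed.

Let fork_inj x y :
  [/\ x (vX i) = y (vX i), x (vB i) = y (vB i), x (vX' i) = y (vX' i),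
      x (vB' i) = y (vB' i) & x (xv n) = y (xv n)] ->
  masked_fork x = masked_fork y -> x = y.
Proof.
move=> [e1 e2 e3 e4 e5] em; apply: masked_inj em _ => v; rewrite !inE.
by do 5!(case: eqP => [-> //|_]).
Qed.

Let actv_out_high c x v : (n - 2 < j)%N -> (level v < n - 1)%N -> actv C j c x v = x v.
Proof.
move=> jn lv; apply: actv_out; have -> : lowest j = (n - 1)%N; last by lia.
by rewrite /lowest !ifF //; lia.
Qed.

Lemma local_pair_penult : j = (n - 1)%N :> nat ->
  local_pair C i j (fun x => x (vX i)) (fun x => x (vB i)) (fun x => x (vX' i))
    (fun x => x (vB' i)) (fun x => x (xv n)) (fun=> 1) masked_fork.
Proof.
move=> jE; have [l1 l2 l3 l4] := level_low i_low.
split.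
- by move=> x x0; rewrite !x0 ltr01.
- by move=> x; rewrite epsv_low // phiv_low.
- by move=> x; rewrite epsv_penult // phiv_penult // mulr1 B'E X'E mulrC.
- move=> c x c0 x0 y xi0; have [yX yB yX' yB'] := actv_low_in c x i_low.
  split; split=> //; last exact: masked_fork_low.
  by apply: actv_out; rewrite level_xv ?lowE; lia.
(* The node n - 1 moves x_(n - 1) but not its bar, so B2 gets the factor 1. *)
- move=> c x c0 x0 y; exists 1; first exact: ltr01.
  have yE := actv_penult c x _ jE.
  have y1 : y (vX' i) = c * x (vX' i) by rewrite X'E /y yE eqxx.
  have y2 : y (vB' i) = x (vB' i) by rewrite B'E /y yE.
  have y3 : y (xv n) = c^-1 * x (xv n) by rewrite /y yE eq_sym xv_penult_last eqxx.
  rewrite y1 y2 y3 !mulr1 mul1r divr1 [_ * c^-1]mulrC.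
  split; split=> //; try by apply: actv_out_high; lia.
  apply/ffunP => v; rewrite /masked_fork /masked ffunE [RHS]ffunE.
  case: ifP => // vs; rewrite /y yE.
  by do 2!(case: eqP => [vE|_]; first by rewrite vE -?X'E !inE eqxx ?orbT in vs).
move=> x y x0 y0 [eX eB er] ee; rewrite !mulr1 => ef; apply: fork_inj => //.
have eB' : x (vB' i) = y (vB' i).
  apply: (mulfI (_ : x (vX' i) / x (vB' i) != 0)); first by rewrite gt_eqF ?divr_gt0.
  by rewrite divfK ?gt_eqF // er divfK ?gt_eqF.
by split=> //; apply: (mulfI (lt0r_neq0 (x0 (vB' i)))); rewrite ee eB'.
Qed.

Lemma local_pair_last : j = n :> nat ->
  local_pair C i j (fun x => x (vX i)) (fun x => x (vB i)) (fun x => x (vX' i))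
    (fun x => x (vB' i)) (fun=> 1) (fun x => x (xv n)) masked_fork.
Proof.
move=> jE; have [l1 l2 l3 l4] := level_low i_low.
split.
- by move=> x x0; rewrite !x0 ltr01.
- by move=> x; rewrite epsv_low // phiv_low.
- by move=> x; rewrite epsv_last // phiv_last // mulr1 B'E X'E.
- move=> c x c0 x0 y xi0; have [yX yB yX' yB'] := actv_low_in c x i_low.
  split; split=> //; last exact: masked_fork_low.
  by apply: actv_out; rewrite level_xv ?lowE; lia.
(* The node n moves the bar of x_(n - 1) but not x_(n - 1), so c s = 1. *)
- move=> c x c0 x0 y; exists c^-1; first by rewrite invr_gt0.
  have yE := actv_last c x _ jE; have c0' := lt0r_neq0 c0.
  have y1 : y (vX' i) = x (vX' i) by rewrite X'E /y yE xv_penult_last.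
  have y2 : y (vB' i) = c^-1 * x (vB' i) by rewrite B'E /y yE eqxx.
  have y3 : y (xv n) = c * x (xv n) by rewrite /y yE eqxx.
  rewrite y1 y2 y3 mulfV // !mul1r invr1 invrK [_ * c]mulrC.
  split; split=> //; try by apply: actv_out_high; lia.
  apply/ffunP => v; rewrite /masked_fork /masked ffunE [RHS]ffunE.
  case: ifP => // vs; rewrite /y yE.
  by do 2!(case: eqP => [vE|_]; first by rewrite vE -?B'E !inE eqxx ?orbT in vs).
move=> x y x0 y0 [eX eB er]; rewrite !mulr1 => eB' ef; apply: fork_inj => //.
have eX' : x (vX' i) = y (vX' i).
  by rewrite -(divfK (lt0r_neq0 (x0 (vB' i))) (x (vX' i))) er eB' divfK ?gt_eqF.
by split=> //; apply: (mulfI (lt0r_neq0 (x0 (vX' i)))); rewrite ef eX'.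
Qed.

End Fork.

Lemma local_pair_adj i j : adjD n i j ->
  exists X1 B1 X2 B2 t t' (T : Type) (inv : {ffun varD n -> R} -> T),
    local_pair C i j X1 B1 X2 B2 t t' inv.
Proof.
have low : (i <= n - 2)%N -> (j <= n - 2)%N -> j = nxt i :> nat -> _ :=
  @local_pair_low i j.
have pen := @local_pair_penult i j; have las := @local_pair_last i j.
case/or3P => /andP[].
- move=> /eqP i0 /eqP j2.
  by do 8!eexists; apply: low; rewrite ?i0 ?j2 /nxt ?i0 //; lia.
- by move=> /eqP iE /eqP jE; do 8!eexists; apply: las.
move=> /andP[i1 i2] /eqP jE; have [ile|ige] := leqP i (n - 3).
  by do 8!eexists; apply: low; rewrite /nxt ?ifF //; lia.
by do 8!eexists; apply: pen; lia.
Qed.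

Definition near_node i (v : varD n) := (lowest i <= level v <= (lowest i).+1)%N.

Lemma near_node_local i x y : (forall v, near_node i v -> x v = y v) ->
  [/\ epsv C i x = epsv C i y, phiv C i x = phiv C i y &
      forall c v, near_node i v -> actv C i c x v = actv C i c y v].
Proof.
rewrite /near_node => xy; have [il|ih] := leqP i (n - 2).
  have [l1 l2 l3 l4] := level_low il.
  rewrite !epsv_low // !phiv_low // !xy ?l1 ?l2 ?l3 ?l4 ?leqnn ?leqnSn //.
  split=> // c v iv; rewrite !actv_low // /xi_low.
  by rewrite !xy ?l1 ?l2 ?l3 ?l4 ?leqnn ?leqnSn.
have loE : lowest i = (n - 1)%N by rewrite /lowest !ifF //; lia.
have x1 : x (xv (n - 1)) = y (xv (n - 1)).
  by apply: xy; rewrite level_xv ?loE; lia.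
have x2 : x (xv n) = y (xv n) by apply: xy; rewrite level_xv ?loE; lia.
have x3 : x (bv (n - 1)) = y (bv (n - 1)).
  by apply: xy; rewrite level_bv ?loE; lia.
have [iE|iE] : i = (n - 1)%N :> nat \/ i = n :> nat by have := ltn_ord i; lia.
  rewrite !epsv_penult // !phiv_penult // x1 x2 x3; split=> // c v /xy vE.
  by rewrite !actv_penult // x1 x2 vE.
rewrite !epsv_last // !phiv_last // x1 x2 x3; split=> // c v /xy vE.
by rewrite !actv_last // x2 x3 vE.
Qed.

Definition commuting_nodes i j :=
  [/\ invariant_under C i j, invariant_under C j i &
    forall c d x, 0 < c -> 0 < d -> positive x ->
      actv C i c (actv C j d x) = actv C j d (actv C i c x)].

Lemma commuting_sym i j : commuting_nodes i j -> commuting_nodes j i.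
Proof. by case=> ij ji com; split=> // c d x c0 d0 x0; rewrite com. Qed.

(** Maps that see and move only disjoint sets of variables commute. *)
Lemma commuting_far i j : (lowest i + 2 <= lowest j)%N -> commuting_nodes i j.
Proof.
move=> ij.
have keep_i c x v : near_node i v -> actv C j c x v = x v.
  by move=> iv; apply: actv_out; rewrite /near_node in iv; lia.
have keep_j c x v : near_node j v -> actv C i c x v = x v.
  by move=> jv; apply: actv_out; rewrite /near_node in jv; lia.
split=> [c x _ _|c x _ _|c d x _ _ _].
- by have [-> -> _] := near_node_local (keep_i c x).
- by have [-> -> _] := near_node_local (keep_j c x).
apply/ffunP => v; have [_ _ ai] := near_node_local (keep_i d x).
have [_ _ aj] := near_node_local (keep_j c x).
have [iv|ni] := boolP (near_node i v); first by rewrite ai // keep_i.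
have [jv|nj] := boolP (near_node j v); last by rewrite !actv_out.
by rewrite aj // keep_j.
Qed.

(** Both nodes move the same four variables, with the roles of x_1 and bar x_1
    exchanged; the xi of the composite is the quotient of the numerators of xi
    at c d and at the parameter of the first map. *)
Lemma commuting_start i j : i = 0%N :> nat -> j = 1%N :> nat -> commuting_nodes i j.
Proof.
move=> i0 j1; have il : (i <= n - 2)%N by rewrite i0.
have jl : (j <= n - 2)%N by rewrite j1; lia.
have XE : vX j = vB i by rewrite /vX /vB i0 j1.
have BE : vB j = vX i by rewrite /vX /vB i0 j1.
have X'E : vX' j = vX' i by rewrite /vX' /nxt i0 j1.
have B'E : vB' j = vB' i by rewrite /vB' /nxt i0 j1.
split=> [c x c0 x0|c x c0 x0|c d x c0 d0 x0].
1,2: have XB0 : 0 < x (vX' i) + x (vB' i) by rewrite addr_gt0.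
1,2: have BX0 : 0 < x (vB' i) + x (vX' i) by rewrite addr_gt0.
1,2: have XcB0 : 0 < x (vX' i) + c * x (vB' i) by rewrite addr_gt0 ?mulr_gt0.
- rewrite !epsv_low // !phiv_low //.
  have [aX aB aX' aB'] := actv_low_in c x jl.
  rewrite XE BE X'E B'E in aX aB aX' aB'.
  by rewrite aX aB aX' aB' /xi_low X'E B'E; split; field; rewrite !gt_eqF.
- rewrite !epsv_low // !phiv_low // XE BE X'E B'E.
  have [aX aB aX' aB'] := actv_low_in c x il.
  by rewrite aX aB aX' aB' /xi_low; split; field; rewrite !gt_eqF.
have XB0 : 0 < x (vX' i) + x (vB' i) by rewrite addr_gt0.
have XdB0 : 0 < x (vX' i) + d * x (vB' i) by rewrite addr_gt0 ?mulr_gt0.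
have XcB0 : 0 < x (vX' i) + c * x (vB' i) by rewrite addr_gt0 ?mulr_gt0.
have XcdB0 : 0 < x (vX' i) + c * d * x (vB' i) by rewrite addr_gt0 ?mulr_gt0.
have [jX jB jX' jB'] := actv_low_in d x jl.
have [iX iB iX' iB'] := actv_low_in c x il.
have [ijX ijB ijX' ijB'] := actv_low_in c (actv C j d x) il.
have [jiX jiB jiX' jiB'] := actv_low_in d (actv C i c x) jl.
rewrite XE BE X'E B'E in jX jB jX' jB' jiX jiB jiX' jiB'.
have xij : xi_low j d x = xi_low i d x by rewrite /xi_low X'E B'E.
have xiE : xi_low i c (actv C j d x) =
    (x (vX' i) + c * d * x (vB' i)) / (x (vX' i) + d * x (vB' i)).
  by rewrite {1}/xi_low jX' jB' xij /xi_low; field; rewrite !gt_eqF // !(addr_gt0, mulr_gt0).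
have xjE : xi_low j d (actv C i c x) =
    (x (vX' i) + c * d * x (vB' i)) / (x (vX' i) + c * x (vB' i)).
  by rewrite {1}/xi_low X'E B'E iX' iB' /xi_low; field; rewrite !gt_eqF // !(addr_gt0, mulr_gt0).
rewrite xiE jX jB jX' jB' xij {xij xiE jX jB jX' jB'}/xi_low in ijX ijB ijX' ijB'.
rewrite xjE iX iB iX' iB' {xjE iX iB iX' iB'}/xi_low in jiX jiB jiX' jiB'.
apply/ffunP => v.
have [->|nX] := eqVneq v (vX i); first by rewrite ijX jiB; field; rewrite !gt_eqF.
have [->|nB] := eqVneq v (vB i); first by rewrite ijB jiX; field; rewrite !gt_eqF.
have [->|nX'] := eqVneq v (vX' i); first by rewrite ijX' jiX'; field; rewrite !gt_eqF.
have [->|nB'] := eqVneq v (vB' i); first by rewrite ijB' jiB'; field; rewrite !gt_eqF.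
have fix_i e z : actv C i e z v = z v.
  by rewrite actv_low // (negPf nX) (negPf nB) (negPf nX') (negPf nB').
have fix_j e z : actv C j e z v = z v.
  by rewrite actv_low // XE BE X'E B'E (negPf nX) (negPf nB) (negPf nX') (negPf nB').
by rewrite fix_i fix_j fix_j fix_i.
Qed.

Lemma commuting_end i j : i = (n - 1)%N :> nat -> j = n :> nat -> commuting_nodes i j.
Proof.
move=> iE jE.
have x12 := xv_penult_last.
have x21 : (xv n == xv (n - 1)) = false by rewrite eq_sym.
split=> [c x c0 x0|c x c0 x0|c d x c0 d0 x0].
- rewrite !epsv_penult // !phiv_penult // !actv_last // !eqxx x12 /=.
  by split=> //; field; rewrite gt_eqF.
- rewrite !epsv_last // !phiv_last // !actv_penult // !eqxx x21 /=.
  by split=> //; field; rewrite gt_eqF.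
have actI e z v : actv C i e z v = _ := actv_penult e z v iE.
have actJ e z v : actv C j e z v = _ := actv_last e z v jE.
apply/ffunP => v; rewrite !(actI, actJ) !eqxx x12 x21 /=.
have [->|_] := eqVneq v (xv (n - 1)); first by rewrite x12.
have [_|_] := eqVneq v (xv n); first by rewrite mulrCA.
by [].
Qed.

Lemma cartanD_diag i : cartanD i i = 2.
Proof. by rewrite /cartanD eqxx. Qed.

Lemma cartanD_eqN1 i j : cartanD i j = -1 -> adjD n i j \/ adjD n j i.
Proof.
rewrite /cartanD; case: ifP => // _; case: ifP => // /orP[]; by [left|right].
Qed.

Lemma has_lax_pair_adj i j : adjD n i j -> has_lax_pair C i j.
Proof.
case/local_pair_adj=> X1 [B1 [X2 [B2 [t [t' [T [inv lp]]]]]]].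
by do 3!eexists; apply: (lax_pair_of_local lp).
Qed.

Lemma exists_adj i : exists j j' b, i = node j j' b /\ adjD n j j'.
Proof.
have [i3|i3] := leqP i (n - 3).
  have jn : (nxt i < n.+1)%N by rewrite /nxt; case: ifP; lia.
  by exists i, (Ordinal jn), true; split=> //; rewrite /adjD /= /nxt; case: ifP; lia.
have n2 : (n - 2 < n.+1)%N by lia.
have n1 : (n - 1 < n.+1)%N by lia.
have iltn := ltn_ord i; have [iE|iE] := leqP i (n - 2).
  by exists i, (Ordinal n1), true; split=> //; rewrite /adjD /=; lia.
by exists (Ordinal n2), i, false; split=> //; rewrite /adjD /=; lia.
Qed.

Lemma cartanD_eq0 i j : cartanD i j = 0 -> commuting_nodes i j.
Proof.
suff main i' j' : (i' < j')%N -> ~~ adjD n i' j' -> commuting_nodes i' j'.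
  rewrite /cartanD; case: ifP => // /eqP ij; case: ifP => // /norP[aij aji] _.
  have [lt|] := ltnP i j; first exact: main.
  rewrite leq_eqVlt => /orP[/eqP/val_inj/esym//|gt].
  by apply: commuting_sym; apply: main.
move=> ij nadj; have jn := ltn_ord j'.
have [far|near] := leqP (lowest i' + 2) (lowest j'); first exact: commuting_far.
have [[i0 j1]|[iE jE]] : (i' = 0%N :> nat /\ j' = 1%N :> nat) \/
    (i' = (n - 1)%N :> nat /\ j' = n :> nat).
- by move: near nadj; rewrite /lowest /adjD; do ?case: ifP; lia.
- exact: commuting_start.
exact: commuting_end.
Qed.

Lemma gammaD i j c x : 0 < c -> positive x ->
  phiv C i (actv C j c x) / epsv C i (actv C j c x) =
  c ^ cartanD i j * (phiv C i x / epsv C i x).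
Proof.
suff: gamma_scaled C i j (cartanD i j) by apply.
have [->|ij] := eqVneq i j.
  rewrite cartanD_diag; have [k [l [b [-> adj]]]] := exists_adj j.
  have [X1 [B1 [X2 [B2 [t [t' [T [inv lp]]]]]]]] := local_pair_adj adj.
  by have [g1 g2 _ _] := gamma_of_local lp; case: b.
have [A0|nA0] := eqVneq (cartanD i j) 0.
  rewrite A0 => c' y c0 y0; rewrite mul1r.
  by have [inv _ _] := cartanD_eq0 A0; have [-> ->] := inv c' y c0 y0.
have AN : cartanD i j = -1.
  by move: nA0; rewrite /cartanD (negPf ij); case: ifP.
have [adj|adj] := cartanD_eqN1 AN; rewrite AN;
by have [X1 [B1 [X2 [B2 [t [t' [T [inv lp]]]]]]]] := local_pair_adj adj;
  have [_ _ ? ?] := gamma_of_local lp.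
Qed.

Theorem geometric_crystal_typeD L : (0 < L)%N ->
  geometric_crystal (@cartanD n) (crystal_prod L C).
Proof.
move=> L_gt0; apply: geometric_crystal_prod => //.
- exact: positive_crystalD.
- exact: gammaD.
- exact: cartanD_diag.
- by move=> i; have [j [k [b [-> /has_lax_pair_adj lax]]]] := exists_adj i; exists j, k, b.
- by move=> i j /cartanD_eqN1[] /has_lax_pair_adj; [left|right].
exact: cartanD_eq0.
Qed.

End TypeDCrystal.

Theorem theorem3p16 (R : realType) (n L : nat) (hn : (4 <= n)%N) (hL : (1 <= L)%N) :
  geometric_crystal (@cartanD n) (crystal_prod L (crystalD n R)).
Proof. exact: geometric_crystal_typeD. Qed.
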